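(* Consider the single-input single-output linear system $\mathcal{S}=(A_0,\ B\,G^{-1}B^\top(A^\top)^{r-1}c,\ c^\top)$. If all invariant zeros of $\mathcal{S}$ have negative real part and $A_0\tilde A$ has no negative real eigenvalues, then the origin is globally exponentially stable for the closed-loop system $\dot x=F(x)$. If $\mathcal{S}$ has a positive real invariant zero, then $\dot x=F(x)$ has unbounded trajectories, i.e. there exists a solution $x:[0,\infty)\to\mathbb{R}^n$ with $\sup_{t\ge0}\|x(t)\|=\infty$.
   Context: Data: $A\in\mathbb{R}^{n\times n}$, $B\in\mathbb{R}^{n\times m}$ with $(A,B)$ stabilizable; $c\in\mathbb{R}^n$, $d\in\mathbb{R}$ with $d>0$; $h(x)=c^\top x+d$. The integer $r\ge 1$ is the relative degree of $h$ for $\dot x=Ax+Bu$: $c^\top A^iB=0$ for $0\le i\le r-2$ and $c^\top A^{r-1}B\neq 0$. $\alpha_1,\dots,\alpha_r>0$ are constants and $\alpha=\prod_{i=1}^r\alpha_i$. $G\in\mathbb{R}^{m\times m}$ is symmetric positive definite. $K\in\mathbb{R}^{m\times n}$ is a nominal gain such that $A_0:=A-BK$ is Hurwitz (all eigenvalues have negative real part). Notation: $\phi(s)=\prod_{j=1}^{r}(s+\alpha_j)$; $\theta=c^\top A^{r-1}B\,G^{-1}B^\top(A^\top)^{r-1}c>0$; $v_1=-\frac{1}{\theta}B\,G^{-1}B^\top(A^\top)^{r-1}c$; $v_2^\top=c^\top(\phi(A)-A^{r-1}BK)$; $\tilde A=A_0+v_1v_2^\top$; $\tilde b=\alpha d\,v_1$;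 $\eta(x)=v_2^\top x+\alpha d$. Closed-loop system: $\dot x=F(x)$ with $F(x)=A_0x$ if $\eta(x)\ge 0$ and $F(x)=\tilde A x+\tilde b$ if $\eta(x)<0$. It arises from $\dot x=Ax+Bu^*(x)$, where $u^*(x)$ is the safety filter, i.e. the minimizer of $\frac12 (u+Kx)^\top G(u+Kx)$ over $u\in\mathbb{R}^m$ subject to $c^\top\phi(A)x+c^\top A^{r-1}Bu+\alpha d\ge 0$. Invariant zero: for a single-input single-output system $(M,b,w^\top)$ with $M\in\mathbb{R}^{n\times n}$, $b,w\in\mathbb{R}^n$ (i.e. $\dot x=Mx+bu$, $y=w^\top x$), a number $z\in\mathbb{C}$ is an invariant zero if $\operatorname{rank}\begin{pmatrix}M-zI&b\\ w^\top&0\end{pmatrix}<n+1$. Globally exponentially stable: there exist $C,\mu>0$ such that every solution satisfies $\|x(t)\|\le Ce^{-\mu t}\|x(0)\|$ for all $t\ge0$. *)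

(* Defs.v *)
From mathcomp Require Export all_boot all_order all_algebra.
From mathcomp Require Export all_classical all_reals all_analysis.
From mathcomp Require Export complex.
Export numFieldNormedType.Exports.

Set Implicit Arguments.
Unset Strict Implicit.
Unset Printing Implicit Defensive.

Import Order.TTheory GRing.Theory Num.Theory.
Local Open Scope classical_set_scope.
Local Open Scope ring_scope.

(* Euclidean norm; the library norm on matrices is the max norm. *)
Definition enorm (R : realType) (n : nat) (x : 'cV[R]_n) : R :=
  Num.sqrt (\sum_(i < n) x i 0 ^+ 2).

Definition posdef (R : realType) (m : nat) (G : 'M[R]_m) : Prop :=
  G^T = G /\ forall u : 'cV[R]_m, u != 0 -> 0 < (u^T *m G *m u) 0 0.

Definition hurwitz (R : realType) (n : nat) (M : 'M[R]_n) : Prop :=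
  forall z : R[i],
    eigenvalue (map_mx (real_complex R) M) z -> complex.Re z < 0.

Definition stabilizable (R : realType) (n m : nat)
    (A : 'M[R]_n) (B : 'M[R]_(n, m)) : Prop :=
  exists L : 'M[R]_(m, n), hurwitz (A - B *m L).

(* i.+1 < r encodes i <= r - 2 without truncated subtraction. *)
Definition relative_degree (R : realType) (n m : nat)
    (A : 'M[R]_n) (B : 'M[R]_(n, m)) (c : 'cV[R]_n) (r : nat) : Prop :=
  [/\ (1 <= r)%N,
      forall i : nat, (i.+1 < r)%N -> c^T *m A ^+ i *m B = 0
    & c^T *m A ^+ r.-1 *m B != 0].

Definition invariant_zero (R : realType) (n : nat)
    (M : 'M[R]_n) (b : 'cV[R]_n) (wT : 'rV[R]_n) (z : R[i]) : Prop :=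
  (\rank (block_mx (map_mx (real_complex R) M - z%:M)
                   (map_mx (real_complex R) b)
                   (map_mx (real_complex R) wT)
                   0) < n + 1)%N.

(* Solutions on [0, +oo[: only the values x t with 0 <= t matter, and the
   derivative at 0 is the right derivative. *)
Definition is_solution (R : realType) (n : nat)
    (F : 'cV[R]_n -> 'cV[R]_n) (x : R -> 'cV[R]_n) : Prop :=
  (fun t : R => t^-1 *: (x t - x 0)) @ 0^'+ --> F (x 0) /\
  forall t : R, 0 < t -> is_derive t (1 : R) x (F (x t)).

Definition globally_exponentially_stable (R : realType) (n : nat)
    (F : 'cV[R]_n -> 'cV[R]_n) : Prop :=
  exists C mu : R, [/\ 0 < C, 0 < mu &
    forall x : R -> 'cV[R]_n, is_solution F x ->
    forall t : R, 0 <= t -> enorm (x t) <= C * expR (- (mu * t)) * enorm (x 0)].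

Definition has_unbounded_trajectory (R : realType) (n : nat)
    (F : 'cV[R]_n -> 'cV[R]_n) : Prop :=
  exists2 x : R -> 'cV[R]_n, is_solution F x &
    ereal_sup [set (enorm (x t))%:E | t in [set t : R | 0 <= t]] = +oo%E.

(* Main.v *)
From HB Require Import structures.
Require Import Defs.
From mathcomp Require Import ring lra zify.
Set Implicit Arguments.
Unset Strict Implicit.
Unset Printing Implicit Defensive.
Import Order.TTheory GRing.Theory Num.Theory.
Local Open Scope classical_set_scope.
Local Open Scope ring_scope.

(** Write [A0] for the nominal closed loop, [A1 = A0 + v1 v2^T] for the loop with
    active constraint, and [phi(s) = prod (s + alpha_j)].  The relative degree
    makes the rows [c^T A^i], [i < r], insensitive to any feedback through [B],
    whence [v2^T = c^T phi(A0)].  The closed loop is [F x = A0 x + psi v1] with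
    [psi = min (eta x) 0].

    Stability.  On the constrained branch [c^T phi(A1) = 0], so an eigenvector of
    [A1] either has an eigenvalue among the [- alpha_j] or is annihilated by
    [c^T], and then its eigenvalue is an invariant zero.  Hence [A1] is Hurwitz
    ([hurwitz_constrained]).  As [psi (v2^T x - psi) >= 0], the loop is a Lur'e
    system with a sector nonlinearity, and exponential stability follows from a
    quadratic form [x^T P x] that decreases along [A0 x + psi v1] for every such
    [psi] ([common_lyapunov]).  With [b = v1 / 2] and [k = v2^T], completing the
    square in [psi] turns this into the Riccati equation
    [A0^T P + P A0 + (P b + k^T)(b^T P + k) = 0].  It is solved through the
    invariant subspace of its Hamiltonian matrix that belongs to the eigenvalues
    with negative real part ([riccati_stabilizing]); this subspace has the right
    dimension once there is no eigenvalue on the imaginary axis, and an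
    eigenvalue [z] there would make [z^2 <= 0] an eigenvalue of [A0 A1]
    ([hamiltonian_eigenvalue]).  This is where the spectral hypothesis enters.
    The Riccati solution only gives a weak decrease; adding a small multiple of
    the solution of a Lyapunov equation for the (Hurwitz) Riccati closed loop
    makes it strict.  Positivity of [P] comes from [A0] being Hurwitz
    ([lyapunov_posdef]).

    The spectral splitting is done over the reals: a real polynomial without
    imaginary roots factors into real polynomials [p q] with the roots of [p] on
    the left and those of [q] on the right of the axis.  That [p(X)] and
    [p(-X)] are then coprime yields, by Bezout relations instead of eigenvectors,
    unique solvability of Lyapunov equations, isotropy of the kernels of [p(M)] for
    Hamiltonian [M], and invertibility of [p(-A0)].

    Instability.  An invariant zero [z > 0] gives [A0 w + u b = z w] with
    [c^T w = 0]; comparing [c^T phi] before and after a feedback that realizes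
    [u] shows [v2^T w = - u theta], so [w] is an eigenvector of [A1] that is not
    in the kernel of [v2^T].  The affine system of the constrained branch has a
    solution polynomial in time; adding a large multiple of [e^(z t) w], with the
    sign making [v2^T w < 0], keeps [eta] negative forever and is unbounded
    ([unstable_affine_unbounded]). *)

(** * Matrix polynomials, Sylvester equations and isotropic kernels *)

Lemma eigenvalue_unitmx (F : fieldType) n (A : 'M[F]_n) a :
  eigenvalue A a = (A - a%:M \notin unitmx).
Proof. by rewrite /eigenvalue /eigenspace kermx_eq0 row_free_unit. Qed.

Lemma trmx_exp (F : comNzRingType) n (A : 'M[F]_n.+1) k : (A ^+ k)^T = A^T ^+ k.
Proof.
elim: k => [|k IH]; first by rewrite !expr0 trmx1.
by rewrite exprS exprSr -!mulmxE trmx_mul IH.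
Qed.

Section PolyMx.
Variable F : fieldType.

Lemma rank_ltP m n (M : 'M[F]_(m, n)) :
  reflect (exists2 v : 'cV[F]_n, v != 0 & M *m v = 0) (\rank M < n)%N.
Proof.
apply: (iffP idP) => [rM | [v v0 Mv]].
- have : kermx M^T != 0.
    by rewrite kermx_eq0 /row_free mxrank_tr neq_ltn rM.
  case/rowV0Pn => u /sub_kermxP uM u0; exists u^T.
    by apply: contra u0 => /eqP u0; rewrite -[u]trmxK u0 trmx0.
  by rewrite -[M]trmxK -trmx_mul uM trmx0.
- rewrite ltn_neqAle rank_leq_col andbT -mxrank_tr; apply: contra v0 => rM.
  rewrite -(inj_eq (can_inj (@trmxK _ _ _))) trmx0.
  by apply/eqP/(row_free_inj rM); rewrite -trmx_mul Mv trmx0 mul0mx.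
Qed.

Lemma eigen_colP n (M : 'M[F]_n) (a : F) :
  reflect (exists2 v : 'cV[F]_n, v != 0 & M *m v = a *: v) (eigenvalue M a).
Proof.
have -> : eigenvalue M a = (\rank (M - a%:M)%R < n)%N.
  by rewrite /eigenvalue /eigenspace kermx_eq0 /row_free ltn_neqAle rank_leq_row andbT.
by apply: (iffP (rank_ltP _)) => -[v v0 Mv]; exists v => //;
  move: Mv; rewrite mulmxBl mul_scalar_mx => /eqP; rewrite ?subr_eq0 => /eqP // ->;
  rewrite subrr.
Qed.

Lemma horner_mx_intertwine m n (A : 'M[F]_m.+1) (B : 'M[F]_n.+1)
    (S : 'M[F]_(m.+1, n.+1)) (p : {poly F}) :
  A *m S = S *m B -> horner_mx A p *m S = S *m horner_mx B p.
Proof.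
move=> AS; elim/poly_ind: p => [|p c IH]; first by rewrite !rmorph0 mul0mx mulmx0.
rewrite !rmorphD !rmorphM /= !horner_mx_X !horner_mx_C -!mulmxE.
by rewrite mulmxDl mulmxDr -mulmxA AS mulmxA IH mulmxA scalar_mxC.
Qed.

Lemma horner_mx_tr n (A : 'M[F]_n.+1) (p : {poly F}) :
  horner_mx A^T p = (horner_mx A p)^T.
Proof.
elim/poly_ind: p => [|p c IH]; first by rewrite !rmorph0 trmx0.
rewrite !rmorphD !rmorphM /= !horner_mx_X !horner_mx_C -!mulmxE.
rewrite linearD /= IH tr_scalar_mx -trmx_mul; congr (_^T + _).
exact: comm_mx_horner.
Qed.

Lemma horner_mxN n (A : 'M[F]_n.+1) (p : {poly F}) :
  horner_mx (- A) p = horner_mx A (p \Po - 'X).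
Proof.
elim/poly_ind: p => [|p c IH]; first by rewrite comp_poly0 !rmorph0.
rewrite comp_polyD comp_polyM comp_polyX comp_polyC !rmorphD !rmorphM /=.
by rewrite rmorphN /= !horner_mx_X !horner_mx_C IH.
Qed.

Lemma comp_poly_oppK (p : {poly F}) : (p \Po - 'X) \Po - 'X = p.
Proof. by rewrite -comp_polyA rmorphN /= comp_polyX opprK comp_polyXr. Qed.

(** Bezout: if [u p + v q = 1] and [p] kills [A], then [v(A)] inverts [q(A)]. *)
Lemma coprime_horner_unit n (A : 'M[F]_n.+1) (p q : {poly F}) :
  coprimep p q -> horner_mx A p = 0 -> horner_mx A q \in unitmx.
Proof.
move=> /Bezout_eq1_coprimepP [[u v] /= uv] pA.
have /mulmx1_unit[_ ->//] : horner_mx A v *m horner_mx A q = 1%:M.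
have <- : horner_mx A 1 = 1%:M by exact: rmorph1.
by rewrite -uv rmorphD !rmorphM /= pA mulr0 add0r mulmxE.
Qed.

(** The equation says that [L] is intertwined by [S] with [- L^T], so
    [0 = p(L) S = S p(- L^T)], and [p(- L)] is invertible.  The coprimality
    hypothesis says that no two roots of [p] are opposite. *)
Lemma sylvester_unique n (L S : 'M[F]_n.+1) (p : {poly F}) :
  coprimep p (p \Po - 'X) -> horner_mx L p = 0 -> L *m S + S *m L^T = 0 -> S = 0.
Proof.
move=> cop pL /eqP; rewrite addr_eq0 -mulmxN => /eqP /horner_mx_intertwine E.
have := E p; rewrite pL mul0mx -linearN horner_mx_tr /= horner_mxN.
have := coprime_horner_unit cop pL; rewrite -unitmx_tr => U E0.
by rewrite -[S](mulmxK U) -E0 mul0mx.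
Qed.

(** The Lyapunov operator is an endomorphism of a finite-dimensional space, hence
    onto as soon as it is injective; the transpose of a solution is a solution,
    so uniqueness also gives symmetry. *)
Lemma lyapunov_solvable n (L Q : 'M[F]_n.+1) (p : {poly F}) :
  coprimep p (p \Po - 'X) -> horner_mx L p = 0 -> Q^T = Q ->
  exists2 S, S^T = S & L *m S + S *m L^T = Q.
Proof.
move=> cop pL Qs.
pose f S := L *m S + S *m L^T.
have f_lin : linear f.
  move=> a S T; rewrite /f mulmxDr mulmxDl -scalemxAr -scalemxAl scalerDr.
  by rewrite addrACA.
pose g := GRing.isLinear.Build F _ _ _ f f_lin.
pose fl : {linear 'M[F]_n.+1 -> 'M[F]_n.+1} := HB.pack f g.
have fU : lin_mx fl \in unitmx.
  rewrite -row_free_unit -kermx_eq0; apply/rowV0P => v /sub_kermxP.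
  rewrite -[v]vec_mxK mul_vec_lin => /(congr1 vec_mx).
  by rewrite mxvecK linear0 => /(sylvester_unique cop pL) ->; rewrite linear0.
have [S fS] : exists S, f S = Q.
  exists (vec_mx (mxvec Q *m invmx (lin_mx fl))); apply: (can_inj mxvecK).
  by rewrite -[LHS](mul_vec_lin fl) vec_mxK mulmxKV.
exists S => //; apply/eqP; rewrite -subr_eq0; apply/eqP.
apply: (sylvester_unique cop pL).
rewrite mulmxBr mulmxBl addrACA -opprD -/(f S) fS.
have -> : L *m S^T + S^T *m L^T = (f S)^T.
  by rewrite /f linearD /= !trmx_mul trmxK addrC.
by rewrite fS Qs subrr.
Qed.

(** The hypothesis on [M] makes [- M] the adjoint of [M] for the form [J], so on
    the kernel of [p(M)] the form vanishes against the image of [p(- M)], which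
    by coprimality contains that kernel. *)
Lemma kermxpoly_isotropic n (M J : 'M[F]_n.+1) (p : {poly F}) :
  coprimep p (p \Po - 'X) -> M *m J = - (J *m M^T) ->
  kermxpoly M p *m J *m (kermxpoly M p)^T = 0.
Proof.
move=> cop MJ; set U := kermxpoly M p; set D := horner_mx M (p \Po - 'X).
have Up : U *m horner_mx M p = 0 by apply/sub_kermxP.
have UJD : U *m J *m D^T = 0.
  move: MJ; rewrite -mulmxN -linearN => /horner_mx_intertwine E.
  by rewrite -mulmxA /D -horner_mxN -horner_mx_tr -E mulmxA Up mul0mx.
case/Bezout_eq1_coprimepP: cop => -[u v] /= uv.
have {2}-> : U = U *m horner_mx M v *m D.
  have -> : U *m horner_mx M v *m D = U *m horner_mx M (u * p + v * (p \Po - 'X)).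
    rewrite rmorphD [u * p]mulrC !rmorphM /= -!mulmxE mulmxDr !mulmxA Up mul0mx.
    by rewrite add0r.
  by rewrite uv rmorph1 mulmx1.
by rewrite trmx_mul mulmxA UJD mul0mx.
Qed.

(** The image of an isotropic subspace under [J] lies in its annihilator. *)
Lemma isotropic_rank n (J U : 'M[F]_n) :
  J \in unitmx -> U *m J *m U^T = 0 -> ((\rank U).*2 <= n)%N.
Proof.
move=> Ju /mulmx0_rank_max; rewrite mxrank_tr mxrankMfree ?addnn //.
by rewrite row_free_unit.
Qed.

Lemma addmx11E (X Y : 'M[F]_1) : (X + Y) 0 0 = X 0 0 + Y 0 0.
Proof. by rewrite mxE. Qed.

Lemma oppmx11E (X : 'M[F]_1) : (- X) 0 0 = - X 0 0.
Proof. by rewrite mxE. Qed.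

Lemma scalemx11E a (X : 'M[F]_1) : (a *: X) 0 0 = a * X 0 0.
Proof. by rewrite mxE. Qed.

Lemma trmx11E (X : 'M[F]_1) : X^T 0 0 = X 0 0.
Proof. by rewrite mxE. Qed.

Lemma mulmx11E (X Y : 'M[F]_1) : (X *m Y) 0 0 = X 0 0 * Y 0 0.
Proof. by rewrite mxE big_ord1. Qed.

End PolyMx.

(** * Stable real polynomials *)

Section Stable.
Variable R : realType.
Local Notation toC := (real_complex R).
Local Notation mapC := (map_poly (real_complex R)).

(** Root locations are recorded on polynomials so that they enter the matrix
    arguments through coprimality alone. *)
Definition stable_poly (p : {poly R}) : Prop :=
  forall z : R[i], root (mapC p) z -> complex.Re z < 0.

Lemma hurwitz_stable n (A : 'M[R]_n.+1) : hurwitz A -> stable_poly (char_poly A).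
Proof.
by move=> HA z; rewrite map_char_poly -eigenvalue_root_char => /HA.
Qed.

Lemma ReN (z : R[i]) : complex.Re (- z) = - complex.Re z.
Proof. by case: z. Qed.

Lemma stable_coprimep (p q : {poly R}) :
  stable_poly p -> stable_poly q -> coprimep p (q \Po - 'X).
Proof.
move=> sp sq; rewrite -(coprimep_map toC).
apply/Pdiv.ClosedField.coprimepP => z /sp z_lt0.
rewrite map_comp_poly rmorphN /= map_polyX horner_comp hornerN hornerX.
apply/negP => /sq; rewrite ReN oppr_lt0 => z_gt0.
by have := lt_trans z_lt0 z_gt0; rewrite ltxx.
Qed.

Lemma conj_fixed_real_poly (p : {poly R[i]}) :
  map_poly conjc p = p -> p = mapC (map_poly (@complex.Re R) p).
Proof.
move=> /polyP pE; apply/polyP => i.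
rewrite coef_map coef_map_id0 //=; have := pE i; rewrite coef_map /=.
case: (p`_i) => a b /= [bE]; congr (Complex _ _).
lra.
Qed.

(** The factors over the complex numbers collect the roots on either side of the
    imaginary axis.  Conjugation permutes the roots of [f] and preserves real
    parts, so both factors are fixed by it and descend to the reals. *)
Lemma hyperbolic_factorization (f : {poly R}) :
  f \is monic -> (forall z, root (mapC f) z -> complex.Re z != 0) ->
  exists p q : {poly R},
    [/\ f = p * q, stable_poly p & stable_poly (q \Po - 'X)].
Proof.
move=> f_mon f_hyp.
have [s fE] := closed_field_poly_normal (mapC f).
rewrite lead_coef_map (monicP f_mon) rmorph1 scale1r in fE.
(* Conjugating a split polynomial conjugates its roots. *)
have conj_root (t : seq R[i]) :
    map_poly conjc (\prod_(z <- t) ('X - z%:P)) = \prod_(z <- map conjc t) ('X - z%:P).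
  by rewrite map_prod_XsubC big_map.
have s_conj : perm_eq (map conjc s) s.
  apply: prod_XsubC_eq; rewrite -conj_root -fE -map_poly_comp /=.
  by apply: eq_map_poly => x /=; rewrite oppr0.
have side (P : pred R) (g := \prod_(z <- s | P (complex.Re z)) ('X - z%:P)) :
    g = mapC (map_poly (@complex.Re R) g).
  apply: conj_fixed_real_poly; rewrite /g -big_filter conj_root.
  apply: perm_big; have Pconj : preim conjc (fun z => P (complex.Re z)) =1
      (fun z : R[i] => P (complex.Re z)) by case.
  by rewrite -[X in map _ X](eq_filter Pconj) -filter_map perm_filter.
have root_side (P : pred R) z :
    root (\prod_(z <- s | P (complex.Re z)) ('X - z%:P)) z -> P (complex.Re z).
  by rewrite -big_filter root_prod_XsubC mem_filter => /andP[].
exists (map_poly (@complex.Re R) (\prod_(z <- s | complex.Re z < 0) ('X - z%:P))).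
exists (map_poly (@complex.Re R) (\prod_(z <- s | ~~ (complex.Re z < 0)) ('X - z%:P))).
split.
- apply: (map_poly_inj toC); rewrite rmorphM /= -(side (fun x => x < 0)).
  by rewrite -(side (fun x => ~~ (x < 0))) fE (bigID (fun z => complex.Re z < 0)).
- by move=> z; rewrite -(side (fun x => x < 0)); exact: (root_side (fun x => x < 0)).
- move=> z; rewrite map_comp_poly rmorphN /= map_polyX.
  rewrite -(side (fun x => ~~ (x < 0))) /root horner_comp hornerN hornerX => rz.
  have := root_side (fun x => ~~ (x < 0)) _ rz; rewrite ReN oppr_lt0 -leNgt => z_le0.
  have : complex.Re (- z) != 0.
    apply: f_hyp; rewrite fE (bigID (fun z => complex.Re z < 0)) /=.
    by rewrite rootM; apply/orP; right.
  by rewrite ReN oppr_eq0 lt_neqAle => ->.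
Qed.

Lemma hurwitz_unitmx n (M : 'M[R]_n.+1) : hurwitz M -> M \in unitmx.
Proof.
move=> hM; apply: contraT => Mu.
have : eigenvalue M 0 by rewrite eigenvalue_unitmx raddf0 subr0.
rewrite -(eigenvalue_map (real_complex R)) => /hM /=.
by rewrite ltxx.
Qed.

End Stable.

(** * The Hamiltonian matrix and the stabilizing Riccati solution *)

Section Hamiltonian.
Variable F : fieldType.

(** The Hamiltonian matrix of the Riccati equation
    [A^T P + P A + (P b + k^T)(b^T P + k) = 0], acting on rows [(x, y)]: the rows
    of [(1, P)] span an invariant subspace exactly when [P] solves the equation. *)
Definition hamiltonian n (A : 'M[F]_n) (b : 'cV[F]_n) (k : 'rV[F]_n) :
    'M[F]_(n + n) :=
  block_mx (A + b *m k)^T (- (k^T *m k)) (b *m b^T) (- (A + b *m k)).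

Definition symplectic_form n : 'M[F]_(n + n) := block_mx 0 1%:M (- 1%:M) 0.

Lemma symplectic_form_unit n : symplectic_form n \in unitmx.
Proof.
have /mulmx1_unit[_ ->//] : - symplectic_form n *m symplectic_form n = 1%:M.
rewrite mulNmx mulmx_block !(mul0mx, mulmx0, mul1mx, mulmx1, addr0, add0r).
by rewrite opp_block_mx !opprK !oppr0 -scalar_mx_block.
Qed.

Lemma hamiltonian_skew n (A : 'M[F]_n) (b : 'cV[F]_n) (k : 'rV[F]_n)
    (M := hamiltonian A b k) (J := symplectic_form n) :
  M *m J = - (J *m M^T).
Proof.
have JT : - J = J^T.
  rewrite /J /symplectic_form tr_block_mx opp_block_mx !trmx0 trmx1 !oppr0 opprK.
  by congr block_mx; rewrite linearN /= trmx1.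
rewrite -mulNmx JT -trmx_mul mulmx_block tr_block_mx.
rewrite !(mul0mx, mulmx0, mul1mx, mulmx1, addr0, add0r, mulmxN, opprK).
by rewrite !trmx_mul !trmxK.
Qed.

End Hamiltonian.
Arguments symplectic_form {F} n.

Section Riccati.
Variable (R : realType) (n : nat).
Variables (A : 'M[R]_n.+1) (b : 'cV[R]_n.+1) (k : 'rV[R]_n.+1).
Local Notation M := (hamiltonian A b k).

(** The stable subspace meets the rows [(0, y)] trivially, i.e. it is a graph over
    the first component.  For such a row in the subspace, isotropy against its
    image gives [(y b)^2 = 0]; the image is then [(0, - y A)], again in the
    subspace, so that [p] annihilates [y] along [- A], where [p(- A)] is
    invertible because [A] is stable too. *)
Lemma costate_rows_zero (p : {poly R}) m (Y : 'M[R]_(m, n.+1)) :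
  stable_poly p -> stable_poly (char_poly A) ->
  (row_mx 0 Y <= kermxpoly M p)%MS -> Y = 0.
Proof.
move=> sp sA; set U := kermxpoly M p => YU.
have iso : U *m symplectic_form n.+1 *m U^T = 0.
  exact: (kermxpoly_isotropic (n := (n + n.+1)%N) (stable_coprimep sp sp)
           (hamiltonian_skew A b k)).
have Ustab : (U *m M <= U)%MS by apply: comm_mx_stable_kermxpoly.
have step (y : 'rV[R]_n.+1) : (row_mx 0 y <= U)%MS ->
    row_mx 0 y *m M = row_mx 0 (y *m - A).
  move=> yU.
  have uM : row_mx 0 y *m M = row_mx (y *m b *m b^T) (- (y *m A) - y *m b *m k).
    rewrite mul_row_block !mul0mx !add0r mulmxN mulmxDr opprD.
    by rewrite !mulmxA.
  have /submxP[D yE] := yU.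
  have /submxP[D' uE] : (row_mx 0 y *m M <= U)%MS.
    by apply: submx_trans Ustab; rewrite submxMr.
  have : row_mx 0 y *m symplectic_form n.+1 *m (row_mx 0 y *m M)^T = 0.
    rewrite uE yE; have -> : D *m U *m symplectic_form n.+1 *m (D' *m U)^T =
      D *m (U *m symplectic_form n.+1 *m U^T) *m D'^T by rewrite trmx_mul !mulmxA.
    by rewrite iso mulmx0 mul0mx.
  rewrite uM tr_row_mx mul_row_block mul_row_col.
  rewrite !(mul0mx, mulmx0, mul1mx, mulmx1, addr0, add0r, mulmxN, mulNmx).
  rewrite trmx_mul trmxK mulmxA.
  rewrite [y *m b]mx11_scalar; set s := (y *m b) 0 0.
  rewrite tr_scalar_mx -scalar_mxM => /(congr1 (fun X : 'M[R]_1 => X 0 0)) /eqP.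
  rewrite !mxE eqxx mulr1n oppr_eq0 mulf_eq0 orbb => /eqP ->.
  by rewrite raddf0 !mul0mx subr0.
pose hM q : 'M[R]_(n.+1 + n.+1) := @horner_mx R (n + n.+1)%N M q.
have hMX q c : hM (q * 'X + c%:P) = M *m hM q + c%:M.
  by rewrite /hM mulrC rmorphD rmorphM /= horner_mx_X horner_mx_C -mulmxE.
have hstep (q : {poly R}) (y : 'rV[R]_n.+1) : (row_mx 0 y <= U)%MS ->
    row_mx 0 y *m hM q = row_mx 0 (y *m horner_mx (- A) q).
  elim/poly_ind: q y => [|q c IH] y yU.
    by rewrite /hM !rmorph0 !mulmx0 row_mx0.
  rewrite hMX [q * _]mulrC !rmorphD !rmorphM /= !horner_mx_X !horner_mx_C -!mulmxE.
  rewrite !mulmxDr !mulmxA step // IH.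
    by rewrite !mul_mx_scalar scale_row_mx scaler0 add_row_mx addr0.
  by rewrite -step //; apply: submx_trans Ustab; rewrite submxMr.
apply/row_matrixP => i; rewrite row0; set y := row i Y.
have yU : (row_mx 0 y <= U)%MS.
  have -> : row_mx 0 y = row i (row_mx 0 Y : 'M[R]_(m, n.+1 + n.+1)).
    by rewrite row_row_mx row0.
  exact: submx_trans (row_sub _ _) YU.
have unit_pA : horner_mx (- A) p \in unitmx.
  rewrite horner_mxN; apply: coprime_horner_unit (Cayley_Hamilton A).
  exact: stable_coprimep.
have : row_mx 0 y *m hM p = 0 by apply/sub_kermxP.
rewrite hstep // => /(congr1 rsubmx); rewrite row_mxKr linear0 => yp.
by rewrite -[y](mulmxK unit_pA) yp mul0mx.
Qed.

(** The kernels of [p(M)] and [q(M)] are both isotropic, so neither has dimension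
    above half of the total, while they span everything: both have exactly half.
    The stable one is a graph of some [P], symmetric by isotropy, and [p]
    annihilates the action of [M] on it, which is the transposed closed loop. *)
Lemma riccati_stabilizing :
  stable_poly (char_poly A) ->
  (forall z, root (map_poly (real_complex R) (char_poly M)) z ->
     complex.Re z != 0) ->
  exists P : 'M[R]_n.+1, exists2 p, stable_poly p &
    [/\ P^T = P,
        A^T *m P + P *m A + (P *m b + k^T) *m (b^T *m P + k) = 0
      & horner_mx (A + b *m (b^T *m P + k))^T p = 0].
Proof.
move=> sA /(hyperbolic_factorization (char_poly_monic _)) [p [q [Mpq sp sq]]].
set U := kermxpoly M p; set V := kermxpoly M q.
set J : 'M[R]_(n.+1 + n.+1) := symplectic_form n.+1.
have isoU : U *m J *m U^T = 0.
  exact: (kermxpoly_isotropic (n := (n + n.+1)%N) (stable_coprimep sp sp)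
           (hamiltonian_skew A b k)).
have isoV : V *m J *m V^T = 0.
  apply: (kermxpoly_isotropic (n := (n + n.+1)%N) _ (hamiltonian_skew A b k)).
  by rewrite coprimep_sym -{2}[q]comp_poly_oppK; apply: stable_coprimep.
have cop : coprimep p q by rewrite -[q]comp_poly_oppK; apply: stable_coprimep.
have rU : (n.+1 <= \rank U)%N.
  have rV : ((\rank V).*2 <= n.+1 + n.+1)%N.
    exact: isotropic_rank (symplectic_form_unit _ _) isoV.
  have : (n.+1 + n.+1 <= \rank U + \rank V)%N.
    have Mpq0 : (kermxpoly M (p * q) :=: 1)%MS.
      by apply: (kermxpoly_min (n := (n + n.+1)%N)); rewrite -Mpq mxminpoly_dvd_char.
    rewrite -[X in (X <= _)%N](mxrank1 R) -Mpq0 (kermxpolyM _ cop).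
    exact: mxrank_adds_leqif.
  by move: rV; rewrite -addnn; lia.
pose e1 : 'M[R]_(n.+1 + n.+1, n.+1) := col_mx 1%:M 0.
pose e2 : 'M[R]_(n.+1 + n.+1, n.+1) := col_mx 0 1%:M.
have splitE m (Z : 'M[R]_(m, n.+1 + n.+1)) : Z = row_mx (Z *m e1) (Z *m e2).
  rewrite -[in RHS](hsubmxK Z) !mul_row_col.
  by rewrite !(mulmx1, mulmx0, addr0, add0r) hsubmxK.
have : row_full (U *m e1).
  rewrite -col_leq_rank; apply: leq_trans rU _.
  rewrite -(mxrank_mul_ker U e1).
  suff -> : \rank (U :&: kermx e1)%MS = 0%N by rewrite addn0.
  apply/eqP; rewrite mxrank_eq0; apply/rowV0P => v.
  rewrite sub_capmx [v in (v <= U)%MS]splitE => /andP[vU /sub_kermxP ve1].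
  rewrite ve1 in vU; rewrite (splitE _ v) ve1.
  by rewrite (costate_rows_zero sp sA vU) row_mx0.
case/row_fullP => D DU; pose P := D *m U *m e2.
have NE : D *m U = row_mx 1%:M P by rewrite (splitE _ (D *m U)) -[_ *m e1]mulmxA DU.
have PT : P^T = P.
  have : row_mx 1%:M P *m J *m (row_mx 1%:M P)^T = 0.
    rewrite -NE; have -> : D *m U *m J *m (D *m U)^T =
      D *m (U *m J *m U^T) *m D^T by rewrite trmx_mul !mulmxA.
    by rewrite isoU mulmx0 mul0mx.
  rewrite tr_row_mx mul_row_block mul_row_col trmx1.
  rewrite !(mul0mx, mulmx0, mul1mx, mulmx1, addr0, add0r, mulmxN, mulNmx).
  by move/eqP; rewrite addrC subr_eq0 => /eqP.
set L := (A + b *m (b^T *m P + k))^T.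
have LE : L = (A + b *m k)^T + P *m (b *m b^T).
  rewrite /L mulmxDr [b *m _ + _]addrC addrA linearD /= mulmxA trmx_mul PT.
  by rewrite trmx_mul trmxK.
have NM : row_mx 1%:M P *m M = row_mx L (- (k^T *m k) - P *m (A + b *m k)).
  by rewrite mul_row_block !mul1mx mulmxN LE.
have NU : (row_mx 1%:M P <= U)%MS by rewrite -NE submxMl.
have NMU : (row_mx 1%:M P *m M <= U)%MS.
  by apply: submx_trans (submxMr _ NU) _; apply: comm_mx_stable_kermxpoly.
have NML : row_mx 1%:M P *m M = L *m row_mx 1%:M P.
  have : (row_mx 1%:M P *m M - L *m row_mx 1%:M P <= U)%MS.
    by rewrite addmx_sub // eqmx_opp; apply: submx_trans (submxMl _ _) NU.
  rewrite NM mul_mx_row mulmx1 opp_row_mx add_row_mx subrr.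
  by move=> /(costate_rows_zero sp sA) /eqP; rewrite subr_eq0 => /eqP ->.
exists P, p => //; split=> //.
- move: NML; rewrite NM mul_mx_row mulmx1 => /eq_row_mx[_].
  rewrite LE [(A + b *m k)^T]linearD /= trmx_mul !mulmxDl !mulmxDr !mulmxA.
  move: (A^T *m P) (P *m A) (P *m b *m b^T *m P) (P *m b *m k) => X1 X2 X3 X4.
  move: (k^T *m b^T *m P) (k^T *m k) => X5 X6 /matrixP E.
  by apply/matrixP => i j; move: (E i j); rewrite !mxE; lra.
- have pL := horner_mx_intertwine (n := (n + n.+1)%N) p (esym NML).
  have pN : horner_mx L p *m (row_mx 1%:M P : 'M[R]_(n.+1, n.+1 + n.+1)) = 0.
    exact: etrans pL (sub_kermxP NU).
  by move: pN; rewrite mul_mx_row mulmx1 => /(congr1 lsubmx); rewrite row_mxKl linear0.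
Qed.
End Riccati.

(** * Imaginary eigenvalues of the Hamiltonian matrix *)

Lemma map_hamiltonian (F L : fieldType) (f : {rmorphism F -> L}) n
    (A : 'M[F]_n) (b : 'cV[F]_n) (k : 'rV[F]_n) :
  map_mx f (hamiltonian A b k) =
  hamiltonian (map_mx f A) (map_mx f b) (map_mx f k).
Proof.
rewrite /hamiltonian map_block_mx !(map_mxN, map_mxD, map_mxM).
by rewrite -!map_trmx !(map_mxD, map_mxM).
Qed.

(** From an eigenrow [(x, y)] put [s = x k^T + y b].  The state part solves
    [(A - z) X = - s b]; let [x2] solve the mirrored equation
    [(A + z) x2 = - s b].  The costate part gives [k x2 = y b], hence
    [k (X + x2) = s], and [X + x2] is an eigenvector of [A (A + 2 b k)] for
    [z^2]. *)
Lemma hamiltonian_eigenvalue (F : fieldType) n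
    (A : 'M[F]_n) (b : 'cV[F]_n) (k : 'rV[F]_n) (z : F) :
  eigenvalue (hamiltonian A b k) z ->
  ~~ eigenvalue A z -> ~~ eigenvalue A (- z) ->
  eigenvalue (A *m (A + (b *+ 2) *m k)) (z ^+ 2).
Proof.
case/eigenvalueP => u Hu u0 zA; rewrite eigenvalue_unitmx negbK => NzA.
have {NzA} : A + z%:M \in unitmx by move: NzA; rewrite rmorphN opprK.
move=> NzA.
move: Hu u0; rewrite -[u]hsubmxK; set x := lsubmx u; set y := rsubmx u.
pose s := (x *m k^T + y *m b) 0 0.
have sE : x *m k^T + y *m b = s%:M by rewrite [LHS]mx11_scalar.
rewrite mul_row_block scale_row_mx => /eq_row_mx[].
have -> : x *m (A + b *m k)^T + y *m (b *m b^T) = x *m A^T + s *: b^T.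
  rewrite -mul_scalar_mx -sE mulmxDl linearD /= trmx_mul mulmxDr !mulmxA.
  by rewrite addrA.
have -> : x *m - (k^T *m k) + y *m - (A + b *m k) = - (y *m A + s *: k).
  rewrite -mul_scalar_mx -sE mulmxDl !mulmxN mulmxDr !mulmxA opprD.
  by rewrite addrC -!opprD -addrA [_ + x *m _ *m _]addrC.
move=> /(congr1 trmx); rewrite linearD /= trmx_mul trmxK !linearZ /= trmxK => Hx Hy u0.
set X := x^T in Hx.
have s0 : s != 0.
  apply: contra u0 => /eqP s0; move: Hx Hy; rewrite s0 !scale0r !addr0 => Hx Hy.
  have x0 : x = 0.
    apply/eqP; apply: contraNT zA => x0; apply/eigen_colP; exists X => //.
    by apply: contra x0 => /eqP x0; rewrite -[x]trmxK -/X x0 trmx0.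
  have y0 : y = 0.
    rewrite -[y](mulmxK NzA) mulmxDr mul_mx_scalar -Hy subrr mul0mx //.
  by rewrite x0 y0 row_mx0.
pose x2 := - s *: (invmx (A + z%:M) *m b).
have Hx2 : A *m x2 + s *: b = - z *: x2.
  have : (A + z%:M) *m x2 = - s *: b by rewrite -scalemxAr mulKVmx.
  rewrite mulmxDl mul_scalar_mx => /eqP; rewrite -subr_eq0 => /eqP E.
  apply/eqP; rewrite -subr_eq0 scaleNr opprK -[X in _ == X]E scaleNr opprK.
  by rewrite addrAC.
have kx2 : k *m x2 = y *m b.
  have : s *: (k *m x2) = s *: (y *m b).
    have -> : s *: (k *m x2) = - (y *m (A + z%:M)) *m x2.
      rewrite mulmxDr mul_mx_scalar -Hy; rewrite opprD opprK addrA addNr add0r.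
      by rewrite -scalemxAl.
    by rewrite mulNmx -mulmxA -scalemxAr mulKVmx // -scalemxAr scaleNr opprK.
  by move/(can_inj (scalerK s0)).
have kz : k *m (X + x2) = s%:M.
  have kX : k *m X = (x *m k^T)^T by rewrite trmx_mul trmxK.
  by rewrite mulmxDr kx2 -sE kX [x *m k^T]mx11_scalar tr_scalar_mx.
apply/eigen_colP; exists (X + x2).
  apply: contra s0 => /eqP E; move: kz; rewrite E mulmx0.
  by move=> /(congr1 (fun X : 'M[F]_1 => X 0 0)); rewrite !mxE eqxx mulr1n => <-.
have Az : A *m X = z *: X - s *: b by rewrite -Hx addrK.
have Ax2 : A *m x2 = - z *: x2 - s *: b by rewrite -Hx2 addrK.
have Atz : (A + b *+ 2 *m k) *m (X + x2) = z *: (X - x2).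
  rewrite mulmxDl -mulmxA kz mul_mx_scalar mulmxDr Az Ax2.
  by rewrite addrACA -opprD -mulr2n scalerMnr subrK scaleNr scalerBr.
rewrite -mulmxA Atz -scalemxAr mulmxBr Az Ax2 scaleNr opprD !opprK addrACA addNr addr0.
by rewrite -scalerDr scalerA expr2.
Qed.

Section Frequency.
Variable (R : realType) (n : nat).
Variables (A : 'M[R]_n.+1) (b : 'cV[R]_n.+1) (k : 'rV[R]_n.+1).

(** On the imaginary axis [z^2] is a nonpositive real number. *)
Lemma hamiltonian_hyperbolic :
  hurwitz A ->
  (forall l : R, l <= 0 -> ~~ eigenvalue (A *m (A + (b *+ 2) *m k)) l) ->
  forall z, root (map_poly (real_complex R) (char_poly (hamiltonian A b k))) z ->
  complex.Re z != 0.
Proof.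
move=> hA neg z; rewrite map_char_poly -eigenvalue_root_char map_hamiltonian => Hz.
apply/negP => /eqP Rez.
have nz (w : R[i]) : complex.Re w = 0 -> ~~ eigenvalue (map_mx (real_complex R) A) w.
  by move=> w0; apply/negP => /hA; rewrite w0 ltxx.
have := hamiltonian_eigenvalue Hz (nz _ Rez) (nz (- z) _).
rewrite ReN Rez oppr0 => /(_ erefl).
have -> : z ^+ 2 = real_complex R (- (complex.Im z) ^+ 2).
  case: z Rez {Hz} => a w /= ->; rewrite expr2; apply/eqP.
  by rewrite eq_complex /= !mul0r mulr0 addr0 sub0r expr2 !eqxx.
have -> : map_mx (real_complex R) b *+ 2 = map_mx (real_complex R) (b *+ 2).
  by rewrite !mulr2n map_mxD.
rewrite -map_mxM -map_mxD -map_mxM eigenvalue_map.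
by apply/negP; apply: neg; rewrite oppr_le0 sqr_ge0.
Qed.
End Frequency.

(** * Positivity of solutions of the Lyapunov inequality *)

(** Rows evolve by [x |-> x A], and [decrease] is the Lyapunov inequality for the
    Hermitian form [P].  Complex scalars are needed because the argument peels
    off one linear factor of an annihilating polynomial at a time. *)
Section ComplexLyapunov.
Variables (C : numClosedFieldType) (n : nat) (A P : 'M[C]_n.+1).
Local Notation form u v := ((u *m P *m map_mx Num.conj (trmx v)) 0 0).

Hypothesis P_herm : map_mx Num.conj P^T = P.
Hypothesis decrease : forall x : 'rV[C]_n.+1, x != 0 ->
  form (x *m A) x + (form (x *m A) x)^* < 0.

Let formC (u v : 'rV[C]_n.+1) : form v u = (form u v)^*.
Proof.
have -> : (form u v)^* = (map_mx Num.conj (u *m P *m map_mx Num.conj v^T)^T) 0 0.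
  by rewrite !mxE.
rewrite !trmx_mul !map_mxM P_herm mulmxA /=; congr ((_ *m _ *m _) 0 0).
by apply/matrixP => i j; rewrite !mxE conjCK.
Qed.

(** Induction on the factors.  Suppose [P] is positive on the invariant subspace
    [W] killed by the product [f] of all factors but [X - l].  A row killed by
    [(X - l) f] splits as [x' + w] with [w] in [W] and [x'] orthogonal to [W] for
    [P].  Then [x' A = l x' + e] with [e] in [W], so the decrease at [x'] equals
    [(l + l^* ) P(x', x')], and [l + l^* < 0] forces [P(x', x') > 0]. *)
Lemma complex_lyapunov_pos (s : seq C) :
  (forall l, l \in s -> l + l^* < 0) ->
  forall x : 'rV[C]_n.+1, x != 0 ->
  x *m horner_mx A (\prod_(l <- s) ('X - l%:P)) = 0 -> 0 < form x x.
Proof.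
elim: s => [|l s IH] neg x x0.
  by rewrite big_nil rmorph1 mulmx1 => x_eq0; rewrite x_eq0 eqxx in x0.
have {}IH := IH (fun l' ls => neg l' (mem_behead (s := l :: s) ls)).
rewrite big_cons; set f := \prod_(l <- s) _ in IH *.
set W := kermx (horner_mx A f); pose B := row_base W.
have IHW (w : 'rV[C]_n.+1) : (w <= B)%MS -> w != 0 -> 0 < form w w.
  by rewrite eq_row_base => /sub_kermxP wf w0; apply: IH.
rewrite rmorphM /= -mulmxE => xf.
pose Bs := map_mx Num.conj B^T; pose Gam := B *m P *m Bs.
have Gam_unit : Gam \in unitmx.
  rewrite -row_free_unit -kermx_eq0; apply/rowV0P => v /sub_kermxP vG.
  have vB : v *m B = 0.
    apply/eqP; apply: contraT => vB0.
    have := IHW _ (submxMl v B) vB0; rewrite trmx_mul map_mxM.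
    have -> : v *m B *m P *m (map_mx Num.conj B^T *m map_mx Num.conj v^T) =
      v *m Gam *m map_mx Num.conj v^T by rewrite /Gam !mulmxA.
    by rewrite vG mul0mx mxE ltxx.
  by apply: (row_free_inj (row_base_free W)); rewrite vB mul0mx.
(* The projection of [x] on [W] that is orthogonal for [P]; [Gam] is the Gram matrix. *)
pose w := x *m P *m Bs *m invmx Gam *m B; pose x' := x - w.
have wB : (w <= B)%MS by apply: submxMl.
have x'B (v : 'rV[C]_n.+1) : (v <= B)%MS -> form x' v = 0.
  case/submxP => d ->; rewrite trmx_mul map_mxM mulmxA.
  have -> : x' *m P *m map_mx Num.conj B^T = 0.
    rewrite /x' !mulmxBl -/Bs /w -![_ *m B *m _]mulmxA.
    rewrite -[x *m P *m Bs *m _ *m _ *m _]mulmxA -/Gam mulmxKV //.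
    by rewrite subrr.
  by rewrite mul0mx mxE.
have formD u v u' v' : form (u + v) (u' + v') =
    form u u' + form u v' + (form v u' + form v v').
  by rewrite linearD map_mxD /= !mulmxDl !mulmxDr !mxE.
have xE : x = x' + w by rewrite subrK.
have -> : form x x = form x' x' + form w w.
  by rewrite {1 2}xE formD (formC x' w) x'B // rmorph0 addr0 add0r.
have w_ge0 : 0 <= form w w.
  have [->|/(IHW _ wB)/ltW //] := eqVneq w 0.
  by rewrite !mul0mx mxE.
have [x'0 | x'0] := eqVneq x' 0.
  have w0 : w != 0 by apply: contra x0 => /eqP w0; rewrite xE x'0 w0 addr0.
  by rewrite x'0 !mul0mx mxE add0r IHW.
apply: ltr_wpDr => //.
have [e eB x'A] : exists2 e : 'rV[C]_n.+1, (e <= B)%MS & x' *m A = l *: x' + e.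
  exists (x' *m A - l *: x'); last by rewrite addrC subrK.
  rewrite eq_row_base; apply/sub_kermxP.
  have -> : x' *m A - l *: x' = x' *m horner_mx A ('X - l%:P).
    by rewrite rmorphB /= horner_mx_X horner_mx_C mulmxBr mul_mx_scalar.
  rewrite -mulmxA /x' mulmxBl xf sub0r.
  have -> : horner_mx A ('X - l%:P) *m horner_mx A f =
            horner_mx A f *m horner_mx A ('X - l%:P).
    by rewrite !mulmxE -!rmorphM mulrC.
  rewrite mulmxA.
  move: wB; rewrite eq_row_base => /sub_kermxP ->.
  by rewrite mul0mx oppr0.
clearbody x' w; have := decrease x'0; rewrite x'A.
have -> : form (l *: x' + e) x' = l * form x' x'.
  have e0 : form e x' = 0 by rewrite formC x'B // rmorph0.
  by rewrite !mulmxDl addmx11E e0 addr0 -!scalemxAl scalemx11E.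
rewrite rmorphM /= -(formC x' x') -mulrDl.
by rewrite nmulr_rlt0 // neg // mem_head.
Qed.
End ComplexLyapunov.

Section RealLyapunov.
Variables (R : realType) (n : nat).
Local Notation toC := (real_complex R).

(** The real part of a form with real matrix is the sum of its values at the real
    and imaginary parts of the argument; this transfers definiteness. *)
Lemma complexify_form (Q : 'M[R]_n.+1) (x : 'rV[R[i]]_n.+1) :
  let h := (x *m map_mx toC Q *m map_mx Num.conj x^T) 0 0 in
  let a := map_mx (@complex.Re R) x in let b := map_mx (@complex.Im R) x in
  h + h^* = toC (2 * ((a *m Q *m a^T) 0 0 + (b *m Q *m b^T) 0 0)).
Proof.
move=> h a b.
have xE : x = map_mx toC a + 'i%C *: map_mx toC b.
  by apply/matrixP => i j; rewrite !mxE [LHS]complexE.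
have xsE : map_mx Num.conj x^T = map_mx toC a^T - 'i%C *: map_mx toC b^T.
  apply/matrixP => i j; rewrite !mxE; apply/eqP.
  by rewrite eq_complex /=; case: (x _ _) => u v /=; apply/andP; split; apply/eqP; ring.
have hE : h = toC ((a *m Q *m a^T) 0 0 + (b *m Q *m b^T) 0 0) +
    'i%C * toC ((b *m Q *m a^T) 0 0 - (a *m Q *m b^T) 0 0).
  rewrite /h xsE xE !mulmxDl !mulmxBr -!scalemxAl -!scalemxAr -!map_mxM.
  rewrite !addmx11E !oppmx11E !scalemx11E ![map_mx _ _ 0 0]mxE.
  have i2 : 'i%C * 'i%C = -1 :> R[i] by rewrite -expr2 sqr_i.
  rewrite !rmorphB !rmorphD /= !mulrA; ring: i2.
rewrite hE; apply/eqP; rewrite eq_complex /=; apply/andP; split; apply/eqP; ring.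
Qed.

(** The complex statement for the roots of the characteristic polynomial of [A],
    which annihilates every row. *)
Lemma lyapunov_posdef (A P : 'M[R]_n.+1) :
  hurwitz A -> P^T = P ->
  (forall x : 'cV[R]_n.+1, x != 0 -> (x^T *m P *m A *m x) 0 0 < 0) ->
  forall x : 'cV[R]_n.+1, x != 0 -> 0 < (x^T *m P *m x) 0 0.
Proof.
move=> hA PT dec x x0.
pose Pc := map_mx toC P; pose Ac := (map_mx toC A)^T.
have conj_map m1 m2 (X : 'M[R]_(m1, m2)) : map_mx Num.conj (map_mx toC X) = map_mx toC X.
  by apply/matrixP => i j; rewrite !mxE /=; apply: conjc_real.
have P_herm : map_mx Num.conj Pc^T = Pc by rewrite /Pc map_trmx PT conj_map.
have dec_row (a : 'rV[R]_n.+1) : a != 0 -> (a *m (A^T *m P) *m a^T) 0 0 < 0.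
  move=> a0; rewrite -trmx11E !trmx_mul PT !trmxK mulmxA -{1}[a]trmxK mulmxA.
  by apply: dec; apply: contra a0 => /eqP a0; rewrite -[a]trmxK a0 trmx0.
have decC (y : 'rV[R[i]]_n.+1) : y != 0 ->
    (y *m Ac *m Pc *m map_mx Num.conj y^T) 0 0 +
    ((y *m Ac *m Pc *m map_mx Num.conj y^T) 0 0)^* < 0.
  move=> y0; rewrite /Ac /Pc map_trmx -[y *m _ *m _]mulmxA -map_mxM complexify_form.
  rewrite -[X in _ < X](rmorph0 toC) ltcR.
  set a := map_mx _ y; set b := map_mx _ y.
  have ab0 : (a != 0) || (b != 0).
    rewrite -negb_and; apply: contra y0 => /andP[/eqP a0 /eqP b0].
    apply/eqP/matrixP => i j; move/matrixP/(_ i j): a0; move/matrixP/(_ i j): b0.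
    by rewrite !mxE; case: (y i j) => u v /= -> ->.
  have form0 : ((0 : 'rV[R]_n.+1) *m (A^T *m P) *m (0 : 'rV[R]_n.+1)^T) 0 0 = 0.
    by rewrite !mul0mx mxE.
  have [a0|a0] := eqVneq a 0; have [b0|b0] := eqVneq b 0.
  - by rewrite a0 b0 eqxx in ab0.
  - by have := dec_row b b0; rewrite a0 form0; lra.
  - by have := dec_row a a0; rewrite b0 form0; lra.
  - by have := dec_row a a0; have := dec_row b b0; lra.
have [s sE] := closed_field_poly_normal (char_poly (map_mx toC A)).
rewrite (monicP (char_poly_monic _)) scale1r in sE.
have negs (l : R[i]) : l \in s -> l + l^* < 0.
  move=> ls; have : complex.Re l < 0.
    by apply: hA; rewrite eigenvalue_root_char sE root_prod_XsubC.
  rewrite [l + _]addcJ -[2%:R](rmorph_nat toC) -rmorphM /= => l0.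
  by rewrite -[X in _ < X](rmorph0 toC) ltcR pmulr_rlt0.
have xc0 : map_mx toC x^T != 0.
  by rewrite map_mx_eq0; apply: contra x0 => /eqP x0; rewrite -[x]trmxK x0 trmx0.
have := complex_lyapunov_pos P_herm decC negs xc0.
rewrite -sE horner_mx_tr Cayley_Hamilton trmx0 mulmx0 => /(_ erefl).
rewrite map_trmx conj_map trmxK -!map_mxM mxE.
by rewrite -[X in X < _](rmorph0 toC) ltcR.
Qed.
End RealLyapunov.

(** * A common quadratic Lyapunov function *)

Section CommonLyapunov.
Variables (R : realType) (n : nat).
Implicit Types x : 'cV[R]_n.+1.

Definition sqnorm x : R := \sum_(i < n.+1) x i 0 ^+ 2.

Lemma sqnormE x : sqnorm x = (x^T *m x) 0 0.
Proof. by rewrite mxE; apply: eq_bigr => i _; rewrite mxE expr2. Qed.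

Lemma sqnorm_ge0 x : 0 <= sqnorm x.
Proof. by apply: sumr_ge0 => i _; apply: sqr_ge0. Qed.

Lemma sqnorm_gt0 x : x != 0 -> 0 < sqnorm x.
Proof.
move=> x0; rewrite lt_neqAle sqnorm_ge0 andbT eq_sym; apply: contra x0.
rewrite psumr_eq0 => [/allP x0|i _]; last exact: sqr_ge0.
apply/eqP/matrixP => i j; rewrite ord1 mxE; apply/eqP.
by have := x0 i (mem_index_enum i); rewrite sqrf_eq0.
Qed.

(** Any constant works that dominates the sum of the absolute values of the
    entries, as each product of two coordinates is at most the squared norm. *)
Lemma form_bound (Q : 'M[R]_n.+1) :
  exists2 c : R, 0 < c & forall x, `|(x^T *m Q *m x) 0 0| <= c * sqnorm x.
Proof.
exists (1 + \sum_(i < n.+1) \sum_(j < n.+1) `|Q i j|).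
  by rewrite ltr_pwDl // sumr_ge0 // => i _; rewrite sumr_ge0.
move=> x; rewrite mulrDl mul1r; apply: ler_wpDl; first exact: sqnorm_ge0.
rewrite mxE; apply: le_trans (ler_norm_sum _ _ _) _.
rewrite exchange_big mulr_suml /=; apply: ler_sum => j _.
rewrite mxE normrM; apply: le_trans (ler_wpM2r _ (ler_norm_sum _ _ _)) _ => //.
rewrite !mulr_suml; apply: ler_sum => i _; rewrite normrM mxE mulrAC mulrC.
apply: ler_wpM2l => //.
have le1 l : `|x l 0| ^+ 2 <= sqnorm x.
  rewrite real_normK ?num_real // /sqnorm (bigD1 l) //= lerDl.
  by apply: sumr_ge0 => l' _; apply: sqr_ge0.
by have := le1 i; have := le1 j; nra.
Qed.

(** With [b = v / 2], [ka = b^T P0 + k] and [q = 2 psi - ka x], the Riccati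
    solution [P0] satisfies
    [2 x^T P0 (A x + psi v) = - q^2 - 4 psi (k x - psi)],
    and the Lyapunov solution [S] for the closed loop [A + b ka] satisfies
    [2 x^T S (A x + psi v) = - |x|^2 + 2 (x^T S b) q].
    In [P = P0 + d S] with [d] small the square [q^2] absorbs the cross term.
    The lower bound is positivity of [P - e], which still satisfies a strict
    Lyapunov inequality for [A]. *)
Lemma common_lyapunov (A : 'M[R]_n.+1) (v : 'cV[R]_n.+1) (k : 'rV[R]_n.+1) :
  hurwitz A ->
  (forall l : R, l <= 0 -> ~~ eigenvalue (A *m (A + v *m k)) l) ->
  exists P : 'M[R]_n.+1, exists e c mu : R,
    [/\ P^T = P, 0 < e, 0 < c, 0 < mu &
      [/\ forall x, e * sqnorm x <= (x^T *m P *m x) 0 0 <= c * sqnorm x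
        & forall x (psi : R), 0 <= psi * ((k *m x) 0 0 - psi) ->
          2 * (x^T *m P *m (A *m x + psi *: v)) 0 0 <= - mu * sqnorm x]].
Proof.
move=> hA spec; pose b := 2^-1 *: v.
have b2 : b *+ 2 = v by rewrite -scaler_nat scalerA divff ?scale1r // pnatr_eq0.
clearbody b.
have [|P0 [p sp [P0T ric pL]]] := @riccati_stabilizing _ _ A b k (hurwitz_stable hA).
  by apply: hamiltonian_hyperbolic => //; rewrite b2.
set ka := b^T *m P0 + k in ric pL; have kaE : ka = b^T *m P0 + k by [].
have kaT : P0 *m b + k^T = ka^T by rewrite /ka linearD /= trmx_mul P0T trmxK.
clearbody ka.
have [|S ST LS] := lyapunov_solvable (stable_coprimep sp sp) pL (Q := - 1%:M).
  by rewrite linearN /= trmx1.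
rewrite trmxK in LS.
have diss0 x psi : 2 * (x^T *m P0 *m (A *m x + psi *: v)) 0 0 =
    - (2 * psi - (ka *m x) 0 0) ^+ 2 - 4 * (psi * ((k *m x) 0 0 - psi)).
  have kk : (x^T *m ka^T *m ka *m x) 0 0 = (ka *m x) 0 0 ^+ 2.
    by rewrite -mulmxA -trmx_mul mulmx11E trmx11E expr2.
  have E1 : 2 * (x^T *m P0 *m A *m x) 0 0 = - (ka *m x) 0 0 ^+ 2.
    move: ric => /(congr1 (fun Q => (x^T *m Q *m x) 0 0)).
    rewrite kaT mulmx0 mul0mx !mulmxDr !mulmxDl !addmx11E !mulmxA.
    have -> : x^T *m A^T *m P0 *m x = (x^T *m P0 *m A *m x)^T.
      by rewrite !trmx_mul trmxK P0T !mulmxA.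
    rewrite trmx11E kk [(0 : 'M[R]_1) 0 0]mxE.
    lra.
  have E2 : (x^T *m P0 *m b) 0 0 = (ka *m x) 0 0 - (k *m x) 0 0.
    rewrite kaE mulmxDl addmx11E addrK -[LHS]trmx11E !trmx_mul trmxK P0T.
    by rewrite mulmxA.
  rewrite mulmxDr addmx11E -scalemxAr scalemx11E -b2 mulr2n mulmxDr addmx11E.
  rewrite E2 mulmxA; move: E1; set t := (_ *m A *m x) 0 0; lra.
have dissS x psi : 2 * (x^T *m S *m (A *m x + psi *: v)) 0 0 =
    - sqnorm x + 2 * (x^T *m S *m b) 0 0 * (2 * psi - (ka *m x) 0 0).
  have E1 : 2 * (x^T *m S *m (A + b *m ka) *m x) 0 0 = - sqnorm x.
    move: (A + b *m ka) LS => Ac /(congr1 (fun Q => (x^T *m Q *m x) 0 0)).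
    rewrite mulmxN mulNmx mulmx1 oppmx11E -sqnormE mulmxDr mulmxDl addmx11E !mulmxA.
    have -> : x^T *m Ac^T *m S *m x = (x^T *m S *m Ac *m x)^T.
      by rewrite !trmx_mul trmxK ST !mulmxA.
    by rewrite trmx11E; lra.
  have E2 : (x^T *m S *m (A + b *m ka) *m x) 0 0 =
      (x^T *m S *m A *m x) 0 0 + (x^T *m S *m b) 0 0 * (ka *m x) 0 0.
    by rewrite -mulmx11E -addmx11E !mulmxA mulmxDr mulmxDl !mulmxA.
  move: E1; rewrite {}E2 mulmxDr addmx11E -scalemxAr scalemx11E -b2 mulr2n.
  rewrite mulmxDr addmx11E mulmxA.
  move: ((x^T *m S *m b) 0 0) ((x^T *m S *m A *m x) 0 0) ((ka *m x) 0 0).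
  by move=> s u g <-; ring.
have [c cgt0 cP] := form_bound (S *m b *m b^T *m S).
(* Chosen such that [2 d s q <= q^2 + d^2 s^2 <= q^2 + (d / 2) |x|^2]
   for [s = x^T S b], as [s^2 <= c |x|^2]. *)
pose d := (2 * c)^-1.
have d0 : 0 < d by rewrite invr_gt0 mulr_gt0.
have dc : d * c = 2^-1 by rewrite /d invfM mulfVK // gt_eqF.
pose P := P0 + d *: S.
have PT : P^T = P by rewrite linearD linearZ /= P0T ST.
have PE : P = P0 + d *: S by [].
clearbody P; have diss x psi : 0 <= psi * ((k *m x) 0 0 - psi) ->
    2 * (x^T *m P *m (A *m x + psi *: v)) 0 0 <= - (d / 2) * sqnorm x.
  have split_form (y : 'cV[R]_n.+1) : (x^T *m P *m y) 0 0 =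
      (x^T *m P0 *m y) 0 0 + d * (x^T *m S *m y) 0 0.
    by rewrite PE mulmxDr mulmxDl addmx11E -scalemxAr -scalemxAl scalemx11E.
  move=> psi_ge0; rewrite split_form mulrDr diss0 [2 * (d * _)]mulrCA dissS.
  have := cP x.
  have -> : (x^T *m (S *m b *m b^T *m S) *m x) 0 0 = (x^T *m S *m b) 0 0 ^+ 2.
    rewrite expr2 -[in X in _ = _ * X](trmx11E (x^T *m S *m b)) -mulmx11E.
    by rewrite !trmx_mul trmxK ST !mulmxA.
  move: (2 * psi - _) ((x^T *m S *m b) 0 0) (sqnorm x) psi_ge0 => q s N.
  move: (psi * _) => w w0; rewrite ger0_norm ?sqr_ge0 // => sN.
  have : d ^+ 2 * s ^+ 2 <= d / 2 * N.
    rewrite expr2 -mulrA -[d / 2 * N]mulrA ler_pM2l // -dc -mulrA ler_pM2l //.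
  have := sqr_ge0 (q - d * s); nra.
have [a a0 aP] := form_bound A.
(* Small enough for the term [2 e x^T A x] to use up at most half of the decrease. *)
pose e := d / (8 * a).
have e0 : 0 < e by rewrite divr_gt0 // mulr_gt0.
have ea : e * a = d / 8.
  rewrite /e invfM mulrA mulfVK // gt_eqF //.
have [c' c'0 c'P] := form_bound P.
exists P, e, c', (d / 2); split=> //; first by rewrite divr_gt0.
split=> [x|//]; apply/andP; split; last exact: le_trans (ler_norm _) (c'P x).
have [->|x0] := eqVneq x 0.
  by rewrite mulmx0 mxE /sqnorm big1 ?mulr0 // => i _; rewrite mxE expr0n.
suff : 0 < (x^T *m (P - e%:M) *m x) 0 0.
  rewrite mulmxBr mulmxBl addmx11E oppmx11E mul_mx_scalar -scalemxAl scalemx11E.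
  by rewrite -sqnormE subr_gt0 => /ltW.
apply: (lyapunov_posdef hA) x0 => [|y y0].
  by rewrite linearB /= PT tr_scalar_mx.
rewrite mulmxBr !mulmxBl addmx11E oppmx11E mul_mx_scalar -!scalemxAl scalemx11E.
have := diss y 0; rewrite mul0r scale0r addr0 lexx => /(_ erefl).
rewrite mulmxA; have := sqnorm_gt0 y0; have := aP y; rewrite ler_norml => /andP[h _].
move: h; move: (sqnorm y) ((y^T *m A *m y) 0 0) ((y^T *m P *m A *m y) 0 0) => N t u.
move=> h N0 h2.
have : - (e * t) <= e * a * N.
  by rewrite -mulrN -mulrA ler_pM2l // lerNl.
rewrite ea; have : 0 < d * N by rewrite mulr_gt0.
lra.
Qed.
End CommonLyapunov.

(** * Output feedback, invariant zeros and the constrained mode *)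

Section Feedback.
Variables (F : fieldType) (n m r : nat).
Variables (A : 'M[F]_n.+1) (B : 'M[F]_(n.+1, m)) (w : 'rV[F]_n.+1).
Hypothesis w_deg : forall i, (i.+1 < r)%N -> w *m A ^+ i *m B = 0.

Lemma feedback_pow (K : 'M[F]_(m, n.+1)) i :
  (i < r)%N -> w *m (A + B *m K) ^+ i = w *m A ^+ i.
Proof.
elim: i => [|i IH] ir //; rewrite !exprSr -!mulmxE !mulmxA IH ?(ltnW ir) //.
by rewrite mulmxDr mulmxA w_deg // mul0mx addr0.
Qed.

(** Powers below the relative degree do not see the feedback, so only the leading
    monomial of [p] contributes. *)
Lemma feedback_poly (K : 'M[F]_(m, n.+1)) (p : {poly F}) :
  (0 < r)%N -> p \is monic -> size p = r.+1 ->
  w *m horner_mx (A + B *m K) p =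
  w *m horner_mx A p + w *m A ^+ r.-1 *m B *m K.
Proof.
case: r w_deg feedback_pow => // s wB fp _ p_mon p_size.
have expand (X : 'M[F]_n.+1) : w *m horner_mx X p =
    \sum_(i < s.+1) p`_i *: (w *m X ^+ i) + w *m X ^+ s *m X.
  rewrite -[in LHS](coefK p) poly_def p_size big_ord_recr /=.
  have -> : p`_s.+1 = 1 by move/monicP: p_mon; rewrite lead_coefE p_size.
  rewrite scale1r rmorphD rmorph_sum /= rmorphXn /= horner_mx_X mulmxDr.
  rewrite mulmx_sumr exprSr -mulmxE mulmxA; congr (_ + _).
  apply: eq_bigr => i _; rewrite -mul_polyC rmorphM rmorphXn /= horner_mx_X horner_mx_C.
  by rewrite -mulmxE mul_scalar_mx scalemxAr.
rewrite !expand fp // mulmxDr mulmxA addrA; congr (_ + _ + _).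
by apply: eq_bigr => i _; rewrite fp.
Qed.

End Feedback.

Lemma horner_mx_eigen (F : fieldType) n (A : 'M[F]_n.+1) (x : 'cV[F]_n.+1) z p :
  A *m x = z *: x -> horner_mx A p *m x = p.[z] *: x.
Proof.
move=> Ax; elim/poly_ind: p => [|p c IH].
  by rewrite rmorph0 mul0mx horner0 scale0r.
rewrite rmorphD rmorphM /= horner_mx_X horner_mx_C hornerMXaddC -mulmxE mulmxDl.
by rewrite -mulmxA Ax -scalemxAr IH mul_scalar_mx scalerA mulrC scalerDl.
Qed.

(** Since [x] is nonzero, some row [k] has [k x = u].  The feedback [A + b k] then
    has [x] as an eigenvector and [w x = 0] kills [w p(A + b k) x], which
    [feedback_poly] compares with [w p(A) x]. *)
Lemma output_zeroing_value (F : fieldType) n r (A : 'M[F]_n.+1) (b : 'cV[F]_n.+1)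
    (w : 'rV[F]_n.+1) (p : {poly F}) (x : 'cV[F]_n.+1) (z u : F) :
  (forall i, (i.+1 < r)%N -> w *m A ^+ i *m b = 0) ->
  (0 < r)%N -> p \is monic -> size p = r.+1 ->
  x != 0 -> A *m x + u *: b = z *: x -> w *m x = 0 ->
  w *m horner_mx A p *m x = - (u *: (w *m A ^+ r.-1 *m b)).
Proof.
move=> w_deg r0 p_mon p_size x0 xz wx.
have [i xi] : exists i, x i 0 != 0.
  apply/existsP; apply: contraNT x0; rewrite negb_exists => /forallP x0.
  by apply/eqP/matrixP => i j; rewrite ord1 mxE; apply/eqP; have := x0 i; rewrite negbK.
pose k : 'rV[F]_n.+1 := (u / x i 0) *: delta_mx 0 i.
have kx : k *m x = u%:M.
  rewrite -scalemxAl -rowE [row i x]mx11_scalar mxE scale_scalar_mx.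
  by rewrite divfK.
have := feedback_poly w_deg k r0 p_mon p_size.
move/(congr1 (fun v => v *m x)); rewrite mulmxDl -[_ *m k *m x]mulmxA kx mul_mx_scalar.
rewrite -mulmxA (horner_mx_eigen (z := z)).
  rewrite -scalemxAr wx scaler0 => /esym/eqP.
  by rewrite addr_eq0 => /eqP.
by rewrite mulmxDl -mulmxA kx mul_mx_scalar.
Qed.

Lemma invariant_zeroP (F : fieldType) n (A : 'M[F]_n) (b : 'cV[F]_n)
    (w : 'rV[F]_n) (z : F) :
  reflect (exists x : 'cV[F]_n, exists2 u : F, (x != 0) || (u != 0) &
      A *m x + u *: b = z *: x /\ w *m x = 0)
    (\rank (block_mx (A - z%:M) b w 0) < n + 1)%N.
Proof.
have blockE (x : 'cV[F]_n) (u : F) :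
    block_mx (A - z%:M) b w 0 *m col_mx x u%:M =
    col_mx (A *m x + u *: b - z *: x) (w *m x).
  rewrite mul_block_col mulmxBl mul_scalar_mx mul_mx_scalar mul0mx addr0.
  by rewrite addrAC.
apply: (iffP (rank_ltP _)) => [[v v0] | [x [u xu [Hx wx]]]].
- move: v0; rewrite -[v]vsubmxK [dsubmx v]mx11_scalar.
  move: (usubmx v) (dsubmx v 0 0) => x u v0; rewrite blockE -[0]vsubmxK.
  move/eq_col_mx; rewrite !linear0 => -[/eqP Hx wx]; exists x, u.
    rewrite -negb_and; apply: contra v0 => /andP[/eqP -> /eqP ->].
    by rewrite raddf0 col_mx0.
  by split=> //; apply/eqP; rewrite -subr_eq0.
- exists (col_mx x u%:M); last by rewrite blockE Hx wx subrr col_mx0.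
  apply: contraTneq xu => /eqP; rewrite col_mx_eq0 => /andP[/eqP -> /eqP u0].
  have -> : u = 0 by move/matrixP/(_ 0 0): u0; rewrite !mxE eqxx mulr1n.
  by rewrite !eqxx.
Qed.

Section Filter.
Variables (R : realType) (n r : nat) (A : 'M[R]_n.+1) (b : 'cV[R]_n.+1).
Variables (w : 'rV[R]_n.+1) (alphas : 'I_r -> R).
Hypothesis w_deg : forall i, (i.+1 < r)%N -> w *m A ^+ i *m b = 0.
Hypothesis r_gt0 : (0 < r)%N.
Let theta := (w *m A ^+ r.-1 *m b) 0 0.
Hypothesis theta_neq0 : theta != 0.
Hypothesis alphas_gt0 : forall i, 0 < alphas i.
Let phi : {poly R} := \prod_(j < r) ('X + (alphas j)%:P).
Let v1 := - theta^-1 *: b.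
Let v2 := w *m horner_mx A phi.

Lemma phi_root_form : phi = \prod_(j < r) ('X - (- alphas j)%:P).
Proof. by apply: eq_bigr => j _; rewrite polyCN opprK. Qed.

Lemma phi_monic : phi \is monic.
Proof. by rewrite phi_root_form; apply: monic_prod_XsubC. Qed.

Lemma size_phi : size phi = r.+1.
Proof. by rewrite phi_root_form size_prod_XsubC /index_enum -enumT size_enum_ord. Qed.

Lemma stable_phi : stable_poly phi.
Proof.
move=> z; rewrite phi_root_form rmorph_prod /= /root horner_prod prodf_seq_eq0.
case/hasP => j _ /=; rewrite map_polyXsubC hornerXsubC subr_eq0 => /eqP ->.
by rewrite /= oppr_lt0.
Qed.

(** The constrained input is chosen to cancel the contribution [v2] of [phi]: the
    output obeys the differential equation with characteristic polynomial
    [phi]. *)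
Lemma constrained_output : w *m horner_mx (A + v1 *m v2) phi = 0.
Proof.
have w_deg' i : (i.+1 < r)%N -> w *m A ^+ i *m v1 = 0.
  by move=> ir; rewrite -scalemxAr w_deg // scaler0.
rewrite (feedback_poly w_deg') ?phi_monic ?size_phi // -/v2.
rewrite -scalemxAr [w *m _ *m b]mx11_scalar -/theta scale_scalar_mx mulNr mulVf //.
by rewrite mul_scalar_mx scaleN1r subrr.
Qed.

(** Applied to an eigenvector, [constrained_output] reads [phi(z) (w x) = 0]. *)
Lemma hurwitz_constrained :
  (forall z : R[i], invariant_zero A b w z -> complex.Re z < 0) ->
  hurwitz (A + v1 *m v2).
Proof.
move=> zeros z /eigen_colP[x x0 xz].
have := congr1 (map_mx (real_complex R)) constrained_output.
rewrite map_mxM map_horner_mx map_mx0 => /(congr1 (fun y => y *m x)).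
rewrite -mulmxA (horner_mx_eigen _ xz) mul0mx -scalemxAr => /eqP.
rewrite scaler_eq0 => /orP[phi0|/eqP wx]; first exact: stable_phi.
apply: zeros; apply/invariant_zeroP; exists x.
exists (real_complex R (- theta^-1) * (map_mx (real_complex R) v2 *m x) 0 0).
  by rewrite x0.
split=> //; rewrite -xz map_mxD mulmxDl; congr (_ + _).
rewrite [map_mx _ (v1 *m _)]map_mxM -mulmxA.
rewrite [map_mx (real_complex R) v2 *m x]mx11_scalar mul_mx_scalar map_mxZ.
by rewrite scalerA mulrC [(_%:M) 0 0]mxE eqxx mulr1n.
Qed.

(** The input direction [u] of the zero is nonzero, since otherwise [z] would be a
    positive eigenvalue of [A]; hence [v2 x] is nonzero and [x] can be rescaled to
    make it negative. *)
Lemma positive_zero_mode (z : R) :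
  hurwitz A -> 0 < z -> invariant_zero A b w (real_complex R z) ->
  exists2 x : 'cV[R]_n.+1, (A + v1 *m v2) *m x = z *: x & (v2 *m x) 0 0 < 0.
Proof.
move=> hA z0; rewrite /invariant_zero.
rewrite -[X in block_mx _ _ _ X](map_mx0 (real_complex R)) -map_scalar_mx -map_mxB.
rewrite -map_block_mx mxrank_map.
case/invariant_zeroP => x [u xu [xz wx]].
have u0 : u != 0.
  apply: contraTneq xu => u0; rewrite u0 eqxx orbF.
  apply: contraL z0 => x0; rewrite -leNgt.
  move: xz; rewrite u0 scale0r addr0 => xz.
  have : eigenvalue (map_mx (real_complex R) A) (real_complex R z).
    by rewrite eigenvalue_map; apply/eigen_colP; exists x.
  by move/hA => /= /ltW.
have x0 : x != 0.
  apply: contraNneq theta_neq0 => x0; move: xz; rewrite x0 mulmx0 scaler0 add0r.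
  move/eqP; rewrite scaler_eq0 (negbTE u0) /= => /eqP b0.
  by rewrite /theta b0 mulmx0 mxE.
have v2x := output_zeroing_value w_deg r_gt0 phi_monic size_phi x0 xz wx.
rewrite -/v2 [w *m _ *m b]mx11_scalar -/theta in v2x.
have mode : (A + v1 *m v2) *m x = z *: x.
  rewrite -xz mulmxDl; congr (_ + _); rewrite -mulmxA v2x scale_scalar_mx.
  rewrite mulmxN mul_mx_scalar /v1 scalerA -scaleNr mulrN opprK.
  by rewrite mulfK.
have v2x0 : (v2 *m x) 0 0 != 0.
  by rewrite v2x scale_scalar_mx !mxE eqxx mulr1n oppr_eq0 mulf_neq0.
exists (- (v2 *m x) 0 0 *: x).
  by rewrite -scalemxAr mode scalerA mulrC -scalerA.
rewrite -scalemxAr scalemx11E mulNr oppr_lt0 -expr2.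
by rewrite lt_neqAle sqr_ge0 andbT eq_sym sqrf_eq0.
Qed.
End Filter.

(** * From a quadratic Lyapunov function to exponential decay *)

Section Trajectories.
Variables (R : realType) (n : nat).
Implicit Types (x : R -> 'cV[R]_n.+1) (t : R).

Lemma is_derive_coord x t (dx : 'cV[R]_n.+1) i j :
  is_derive t (1 : R) x dx -> is_derive t (1 : R) (fun s => x s i j) (dx i j).
Proof.
move=> [D <-]; apply: DeriveDef; first exact: (derivable_mxP _ _ _).1.
by rewrite derive_mx // mxE.
Qed.

Lemma is_derive_mx x t (dx : 'cV[R]_n.+1) :
  (forall i j, is_derive t (1 : R) (fun s => x s i j) (dx i j)) ->
  is_derive t (1 : R) x dx.
Proof.
move=> H; have D : derivable x t 1 by apply/derivable_mxP => i j; case: (H i j).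
apply: DeriveDef => //; rewrite derive_mx //.
by apply/matrixP => i j; rewrite mxE; case: (H i j).
Qed.

Lemma formE (P : 'M[R]_n.+1) (u v : 'cV[R]_n.+1) :
  (u^T *m P *m v) 0 0 = \sum_(j < n.+1) \sum_(i < n.+1) P i j * (u i 0 * v j 0).
Proof.
rewrite mxE; apply: eq_bigr => j _; rewrite mxE mulr_suml.
by apply: eq_bigr => i _; rewrite mxE; ring.
Qed.

Lemma is_derive_form (P : 'M[R]_n.+1) x t (dx : 'cV[R]_n.+1) : P^T = P ->
  is_derive t (1 : R) x dx ->
  is_derive t (1 : R) (fun s => ((x s)^T *m P *m x s) 0 0)
    (2 * ((x t)^T *m P *m dx) 0 0).
Proof.
move=> PT D.
have -> : (fun s => ((x s)^T *m P *m x s) 0 0) =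
    \sum_(j < n.+1) \sum_(i < n.+1) (P i j \*: ((fun s => x s i 0) * (fun s => x s j 0))).
  apply/funext => s; rewrite formE fct_sumE; apply: eq_bigr => j _.
  by rewrite fct_sumE.
have Dc i := @is_derive_coord x t dx i 0 D.
apply: is_derive_eq.
have E : (dx^T *m P *m x t) 0 0 = ((x t)^T *m P *m dx) 0 0.
  by rewrite -trmx11E !trmx_mul trmxK PT mulmxA.
rewrite mulr_natl mulr2n -[X in _ = X + _]E !formE -big_split /=.
apply: eq_bigr => j _; rewrite -big_split /=; apply: eq_bigr => i _.
by rewrite /GRing.scale /=; ring.
Qed.

(** Solutions come with a right derivative at [0] only; it still gives right
    continuity there. *)
Lemma right_continuous_at0 x (dx : 'cV[R]_n.+1) :
  (fun t => t^-1 *: (x t - x 0)) @ 0^'+ --> dx -> x t @[t --> 0^'+] --> x 0.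
Proof.
move=> D.
have : (t *: (t^-1 *: (x t - x 0)) + x 0) @[t --> 0^'+] --> 0 *: dx + x 0.
  apply: cvgD; last exact: cvg_cst.
  apply: cvgZ => //; apply: cvg_at_right_filter; exact: cvg_id.
rewrite scale0r add0r; apply: cvg_trans; apply: near_eq_cvg.
near=> t; rewrite scalerA divff ?scale1r ?subrK // gt_eqF //.
Unshelve. all: by end_near. Qed.

Lemma form_continuous (P : 'M[R]_n.+1) (F : set_system R) (FF : Filter F)
    x (l : 'cV[R]_n.+1) :
  x t @[t --> F] --> l ->
  ((x t)^T *m P *m x t) 0 0 @[t --> F] --> (l^T *m P *m l) 0 0.
Proof.
move=> xl; have xi i : x t i 0 @[t --> F] --> l i 0.
  exact: (cvg_comp _ _ xl (@coord_continuous R _ _ i 0 l)).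
rewrite formE; under eq_fun do rewrite formE.
apply: cvg_big => // [|j _]; first exact: add_continuous.
apply: cvg_big => // [|i _]; first exact: add_continuous.
by apply: cvgM; [exact: cvg_cst | apply: cvgM].
Qed.

(** The function [e^(kap t) V(x t)], with [V] the form of [P] and [kap = mu / c],
    is nonincreasing; the bounds of [V] translate this to the norm, whose rate
    is [kap / 2] as [V] is quadratic. *)
Lemma lyapunov_ges (f : 'cV[R]_n.+1 -> 'cV[R]_n.+1) (P : 'M[R]_n.+1) (e c mu : R) :
  P^T = P -> 0 < e -> 0 < c -> 0 < mu ->
  (forall y : 'cV[R]_n.+1, e * sqnorm y <= (y^T *m P *m y) 0 0 <= c * sqnorm y) ->
  (forall y : 'cV[R]_n.+1, 2 * (y^T *m P *m f y) 0 0 <= - mu * sqnorm y) ->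
  globally_exponentially_stable f.
Proof.
move=> PT e0 c0 mu0 bounds decay.
pose kap := mu / c.
have kap0 : 0 < kap by rewrite divr_gt0.
exists (Num.sqrt (c / e)), (kap / 2); split; rewrite ?sqrtr_gt0 ?divr_gt0 //.
move=> x [x_0 x_sol] t t_ge0.
pose V (s : R) : R := ((x s)^T *m P *m x s) 0 0.
pose W (s : R) : R := expR (kap * s) * V s.
have dW (s : R) : 0 < s -> is_derive s (1 : R) W
    (expR (kap * s) * (kap * V s + 2 * ((x s)^T *m P *m f (x s)) 0 0)).
  move=> s0; have dV := is_derive_form PT (x_sol s s0).
  have -> : W = (expR \o (kap \*: id)) * V by apply/funext.
  apply: is_derive_eq; rewrite /GRing.scale /=; ring.
have Wdec : W t <= W 0.
  have [->//|tn0] := eqVneq t 0.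
  have t0 : 0 < t by rewrite lt_neqAle eq_sym tn0.
  apply: (@ler0_derive1_nincr R W 0 t) => //.
  - by move=> s; rewrite in_itv /= => /andP[s0 _]; case: (dW s s0).
  - move=> s; rewrite in_itv /= => /andP[s0 _]; rewrite derive1E.
    case: (dW s s0) => _ ->; rewrite pmulr_rle0 ?expR_gt0 //.
    have := decay (x s); have /andP[_ ] := bounds (x s); rewrite -/(V s) => Vc Vd.
    have : kap * V s <= mu * sqnorm (x s).
      rewrite /kap -mulrA ler_pM2l // ler_pdivrMl //.
    by move: Vd; lra.
  - have cW (s : R) : 0 < s -> {for s, continuous W}.
      move=> s0; apply/differentiable_continuous/derivable1_diffP.
      by case: (dW s s0).
    apply/continuous_within_itvP => //; split.
    + by move=> s; rewrite in_itv /= => /andP[/cW].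
    + apply: cvgM.
        apply: cvg_at_right_filter.
        apply: continuous_comp; last exact: continuous_expR.
        by apply: cvgMr; exact: cvg_id.
      apply: form_continuous; exact: right_continuous_at0 x_0.
    + by apply: cvg_at_left_filter; apply: cW.
have sqn : sqnorm (x t) <= c / e * expR (- (kap / 2 * t)) ^+ 2 * sqnorm (x 0).
  have -> : expR (- (kap / 2 * t)) ^+ 2 = expR (- (kap * t)).
    by rewrite -expRM_natl; congr expR; field.
  have /andP[V_ge _] := bounds (x t); have /andP[_ V_le] := bounds (x 0).
  move: Wdec; rewrite /W mulr0 expR0 mul1r => Wdec.
  rewrite -(ler_pM2l e0); apply: le_trans V_ge _.
  rewrite -(ler_pM2l (expR_gt0 (kap * t))); apply: le_trans Wdec _.
  apply: le_trans V_le _; rewrite expRN.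
  have := expR_gt0 (kap * t) => E0.
  rewrite le_eqVlt; apply/orP; left; apply/eqP; field.
  by rewrite !gt_eqF.
rewrite /enorm -/(sqnorm (x t)) -/(sqnorm (x 0)).
apply: le_trans (ler_wsqrtr sqn) _.
have ce0 : 0 <= c / e by rewrite divr_ge0 // ltW.
rewrite sqrtrM; last by rewrite mulr_ge0 // sqr_ge0.
by rewrite sqrtrM // sqrtr_sqr ger0_norm ?expR_ge0.
Qed.
End Trajectories.

(** * Escaping trajectories *)

(** Fitting decomposition: the range of a high power of [M] is already the range
    of its square.  Write the characteristic polynomial as [X^k g] with
    [g(0) <> 0]; [X^(k+1)] and [g] are coprime, and a Bezout relation multiplied
    by [X^(k+1)] gives the claim by Cayley-Hamilton. *)
Lemma fitting_range (F : fieldType) n (M : 'M[F]_n.+1) :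
  exists k : nat, exists X : 'M[F]_n.+1, M ^+ k.+1 = M ^+ k.+1 *m M ^+ k.+1 *m X.
Proof.
have [k [g]] := multiplicity_XsubC (char_poly M) 0.
rewrite (monic_neq0 (char_poly_monic M)) /= subr0 => g0 chiE.
exists k.
have /Bezout_eq1_coprimepP[[u v] /= uv] : coprimep ('X ^+ k.+1) g.
  by rewrite coprimep_expl // coprimep_sym coprimepX.
exists (horner_mx M u).
have Xk j : M ^+ j = horner_mx M ('X ^+ j) by rewrite rmorphXn /= horner_mx_X.
rewrite Xk !mulmxE -!rmorphM.
have -> : 'X ^+ k.+1 * 'X ^+ k.+1 * u = 'X ^+ k.+1 - v * 'X * char_poly M.
  by rewrite -[in RHS](mulr1 ('X ^+ k.+1)) -uv chiE exprS; ring.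
by rewrite rmorphB [v * 'X * _]mulrC rmorphM /= Cayley_Hamilton mul0r subr0.
Qed.

Section Unbounded.
Variables (R : realType) (n : nat).

Lemma is_derive_vector_poly k (a : nat -> 'cV[R]_n.+1) (t : R) :
  is_derive t (1 : R) (fun s : R => \sum_(j < k.+1) s ^+ j *: a j)
    (\sum_(j < k) t ^+ j *: (a j.+1 *+ j.+1)).
Proof.
apply: is_derive_mx => i l.
have -> : (fun s : R => (\sum_(j < k.+1) s ^+ j *: a j) i l) =
    horner (\poly_(j < k.+1) a j i l).
  apply/funext => s; rewrite horner_poly summxE; apply: eq_bigr => j _.
  by rewrite mxE mulrC.
have -> : (\sum_(j < k) t ^+ j *: (a j.+1 *+ j.+1)) i l =
    ((\poly_(j < k.+1) a j i l)^`()).[t].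
  have -> : (\poly_(j < k.+1) a j i l)^`() = \poly_(j < k) (a j.+1 i l *+ j.+1).
    by apply/polyP => j; rewrite coef_deriv !coef_poly ltnS; case: ifP; rewrite ?mul0rn.
  rewrite horner_poly summxE; apply: eq_bigr => j _.
  by rewrite mxE mulmxnE mulrC.
exact: is_derive_poly.
Qed.

(** If [M] is invertible there is an equilibrium, but [0] may be an eigenvalue of
    [M].  By [fitting_range], [b] is the sum of [M^(k+1) X b], compensated by the
    constant [- M^k X b], and of a vector [b0] killed by [M^(k+1)], for which the
    exponential series of [M] stops. *)
Lemma affine_polynomial_solution (M : 'M[R]_n.+1) (b : 'cV[R]_n.+1) :
  exists k : nat, exists a : nat -> 'cV[R]_n.+1, forall t : R,
    is_derive t (1 : R) (fun s : R => \sum_(j < k) s ^+ j *: a j)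
      (M *m (\sum_(j < k) t ^+ j *: a j) + b).
Proof.
have [k [X MX]] := fitting_range M.
pose b0 := b - M ^+ k.+1 *m X *m b.
(* Coefficients of [- M^k X b + sum_j t^(j+1) / (j+1)! M^j b0]. *)
pose a j := if j is j'.+1 then (j'.+1 `! %:R)^-1 *: (M ^+ j' *m b0)
            else - (M ^+ k *m X *m b).
have Mb0 : M ^+ k.+1 *m b0 = 0.
  by rewrite /b0 mulmxBr !mulmxA -MX subrr.
have aS j : a j.+1 *+ j.+1 = (j`! %:R)^-1 *: (M ^+ j *m b0).
  by rewrite /a -scaler_nat scalerA factS natrM invfM mulrA divff ?mul1r //.
have MS j : M *m (M ^+ j *m b0) = M ^+ j.+1 *m b0 by rewrite exprS -mulmxE mulmxA.
have b0E : b0 = b - M ^+ k.+1 *m X *m b by [].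
exists k.+2, a => t; clearbody b0.
suff <- : \sum_(j < k.+1) t ^+ j *: (a j.+1 *+ j.+1) =
    M *m (\sum_(j < k.+2) t ^+ j *: a j) + b by apply: is_derive_vector_poly.
rewrite mulmx_sumr big_ord_recl [in RHS]big_ord_recl [in RHS]big_ord_recr /=.
rewrite -!scalemxAr MS Mb0 !scaler0 addr0 !expr0 !scale1r aS fact0 invr1 scale1r.
rewrite mulmxN mul1mx !mulmxA mulmxE -exprS -mulmxE addrAC; congr (_ + _).
  by rewrite b0E addrC.
apply: eq_bigr => j _; rewrite /bump /= add1n aS -scalemxAr -scalemxAr MS //.
Qed.

Lemma monomial_le_exp (z : R) j : 0 < z ->
  exists2 C : R, 0 <= C & forall t, 0 <= t -> t ^+ j <= C * expR (z * t).
Proof.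
move=> z0; case: j => [|j].
  by exists 1 => // t t0; rewrite expr0 mul1r -expR0 ler_expR mulr_ge0 // ltW.
exists (j.+1 `! %:R / z ^+ j.+1).
  by rewrite divr_ge0 ?ler0n // exprn_ge0 // ltW.
move=> t t0; have f0 : (0 : R) < j.+1 `! %:R by rewrite ltr0n fact_gt0.
have zt0 : 0 <= z * t by rewrite mulr_ge0 // ltW.
have : (z * t) ^+ j.+1 / j.+1 `! %:R <= expR (z * t).
  by apply: le_trans _ (expR_ge1Dxn j zt0); rewrite lerDr.
rewrite ler_pdivrMr // exprMn => H.
by rewrite mulrAC ler_pdivlMr ?exprn_gt0 // mulrC [_%:R * _]mulrC.
Qed.

(** Along [s e^(z t) w + y t], with [y] the polynomial solution, the value of [v] is
    at most [- e^(z t) - e] once [s] is large: the trajectory stays where [f] is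
    affine, and it is unbounded because [v] is. *)
Lemma unstable_affine_unbounded (M : 'M[R]_n.+1) (bt w : 'cV[R]_n.+1)
    (v : 'rV[R]_n.+1) (z e : R) (f : 'cV[R]_n.+1 -> 'cV[R]_n.+1) :
  0 < z -> 0 < e -> M *m w = z *: w -> (v *m w) 0 0 < 0 ->
  (forall x : 'cV[R]_n.+1, (v *m x) 0 0 + e < 0 -> f x = M *m x + bt) ->
  has_unbounded_trajectory f.
Proof.
move=> z0 e0 Mw vw fE.
have [k [a ya]] := affine_polynomial_solution M bt.
pose y (t : R) : 'cV[R]_n.+1 := \sum_(j < k) t ^+ j *: a j.
have [C C0 yC] : exists2 C : R, 0 <= C &
    forall t, 0 <= t -> (v *m y t) 0 0 <= C * expR (z * t).
  have /choice[D HD] (j : nat) : exists D : R, 0 <= D /\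
      forall t, 0 <= t -> t ^+ j <= D * expR (z * t).
    by have [D D0 HD] := monomial_le_exp j z0; exists D.
  exists (\sum_(j < k) `|(v *m a j) 0 0| * D j).
    by apply: sumr_ge0 => j _; rewrite mulr_ge0 //; case: (HD j).
  move=> t t0; rewrite mulmx_sumr summxE mulr_suml; apply: ler_sum => j _.
  rewrite -scalemxAr scalemx11E.
  apply: le_trans (ler_norm _) _; rewrite normrM [X in X * _]ger0_norm ?exprn_ge0 //.
  by rewrite mulrC -mulrA ler_wpM2l //; case: (HD j) => _; apply.
(* [C] bounds the growth of [v (y t)] relative to [e^(z t)]; the summand [e] covers
   the offset and [1] leaves the margin that makes the trajectory unbounded. *)
pose s := (C + e + 1) / - (v *m w) 0 0.
pose x (t : R) : 'cV[R]_n.+1 := (s * expR (z * t)) *: w + y t.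
have vx (t : R) : 0 <= t -> (v *m x t) 0 0 + e <= - expR (z * t).
  move=> t0; rewrite /x mulmxDr addmx11E -scalemxAr scalemx11E.
  have := yC t t0; have : 1 <= expR (z * t).
    by rewrite -expR0 ler_expR mulr_ge0 // ltW.
  have -> : s * expR (z * t) * (v *m w) 0 0 = - (C + e + 1) * expR (z * t).
    by rewrite /s; field; rewrite lt_eqF.
  move: (expR _) ((v *m y t) 0 0) => E Y; nra.
have fx (t : R) : 0 <= t -> f (x t) = M *m x t + bt.
  by move=> t0; apply: fE; apply: le_lt_trans (vx t t0) _; rewrite oppr_lt0 expR_gt0.
have dx (t : R) : 0 <= t -> is_derive t (1 : R) x (f (x t)).
  move=> t0; rewrite fx // {2}/x mulmxDr -addrA.
  have -> : x = (fun u : R => (s * expR (z * u)) *: w) + y by [].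
  apply: (is_deriveD _ (ya t)); apply: is_derive_mx => i l.
  have -> : (fun u : R => (s * expR (z * u) *: w) i l) =
      (s * w i l) \*: (expR \o (z \*: id)).
    by apply/funext => u; rewrite mxE /= /GRing.scale /=; ring.
  apply: is_derive_eq; rewrite -scalemxAr Mw !mxE /GRing.scale /=; ring.
exists x.
  split=> [|t /ltW]; last exact: dx.
  case: (dx 0 (lexx _)) => D <-.
  have -> : (fun t => t^-1 *: (x t - x 0)) =
      (fun h => h^-1 *: ((x \o shift 0) (h *: 1) - x 0)).
    by apply/funext => h; rewrite /= addr0 [h *: 1]mulr1.
  exact: cvg_dnbhs_at_right D.
have [c c0 cP] := form_bound (v^T *m v).
apply/eqyP => B B0.
(* [e^(z t) >= z t] already reaches the bound at this time. *)
pose t := c * (B ^+ 2) / z.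
have t0 : 0 <= t by rewrite divr_ge0 ?mulr_ge0 ?sqr_ge0 // ltW.
apply: le_trans _ (ereal_sup_ubound _); last by exists t.
rewrite lee_fin -[B](ger0_norm (ltW B0)) -sqrtr_sqr /enorm; apply: ler_wsqrtr.
rewrite -/(sqnorm (x t)).
have := cP (x t).
have -> : ((x t)^T *m (v^T *m v) *m x t) 0 0 = (v *m x t) 0 0 ^+ 2.
  by rewrite mulmxA -trmx_mul -mulmxA mulmx11E trmx11E expr2.
rewrite ger0_norm ?sqr_ge0 // => H.
have E1 : c * B ^+ 2 <= expR (z * t).
  have -> : z * t = c * B ^+ 2 by rewrite /t mulrC divfK // gt_eqF.
  by apply: le_trans _ (expR_ge1Dx _); rewrite lerDr.
have := vx t t0; move: E1 H (expR_ge0 (z * t)).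
have : 1 <= expR (z * t) by rewrite -expR0 ler_expR mulr_ge0 // ltW.
move: (expR _) ((v *m x t) 0 0) (sqnorm _) => E V N E_ge1 E1 H E_ge0 V_le.
rewrite -(ler_pM2l c0); apply: le_trans E1 _; apply: le_trans H.
nra.
Qed.

End Unbounded.

(** * The safety filter loop *)

Lemma posdef_unitmx (R : realType) m (G : 'M[R]_m) : posdef G -> G \in unitmx.
Proof.
case=> _ G_pos; rewrite -row_free_unit -kermx_eq0; apply/rowV0P => v /sub_kermxP vG.
apply/eqP; apply: contraT => v0.
have := G_pos v^T; rewrite trmxK vG mul0mx mxE ltxx; apply.
by apply: contra v0 => /eqP v0; rewrite -[v]trmxK v0 trmx0.
Qed.

(** With [u = G^-1 g^T] the value is [u^T G u]. *)
Lemma posdef_inv_gt0 (R : realType) m (G : 'M[R]_m) (g : 'rV[R]_m) :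
  posdef G -> g != 0 -> 0 < (g *m invmx G *m g^T) 0 0.
Proof.
move=> Gp g0; have Gu := posdef_unitmx Gp; case: Gp => GT G_pos.
have := G_pos (invmx G *m g^T).
rewrite trmx_mul trmxK trmx_inv GT !mulmxA mulmxKV //; apply.
apply: contra g0 => /eqP E; rewrite -[g]trmxK -[g^T](mulKVmx Gu) E mulmx0 trmx0.
by [].
Qed.

Theorem corollary9 (R : realType) (n m r : nat)
    (A : 'M[R]_n.+1) (B : 'M[R]_(n.+1, m)) (c : 'cV[R]_n.+1) (d : R)
    (alphas : 'I_r -> R) (G : 'M[R]_m) (K : 'M[R]_(m, n.+1)) :
  stabilizable A B ->
  0 < d ->
  relative_degree A B c r ->
  (forall i, 0 < alphas i) ->
  posdef G ->
  hurwitz (A - B *m K) ->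
  let A0 : 'M[R]_n.+1 := A - B *m K in
  let alpha : R := \prod_(i < r) alphas i in
  let phi : {poly R} := \prod_(j < r) ('X + (alphas j)%:P) in
  let b : 'cV[R]_n.+1 := B *m invmx G *m B^T *m A^T ^+ r.-1 *m c in
  let theta : R := (c^T *m A ^+ r.-1 *m b) 0 0 in
  let v1 : 'cV[R]_n.+1 := - theta^-1 *: b in
  let v2T : 'rV[R]_n.+1 := c^T *m (horner_mx A phi - A ^+ r.-1 *m B *m K) in
  let Atilde : 'M[R]_n.+1 := A0 + v1 *m v2T in
  let btilde : 'cV[R]_n.+1 := (alpha * d) *: v1 in
  let eta (x : 'cV[R]_n.+1) : R := (v2T *m x) 0 0 + alpha * d in
  let F (x : 'cV[R]_n.+1) : 'cV[R]_n.+1 :=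
    if 0 <= eta x then A0 *m x else Atilde *m x + btilde in
  ((forall z : R[i], invariant_zero A0 b c^T z -> complex.Re z < 0) ->
   (forall l : R, l < 0 -> ~~ eigenvalue (A0 *m Atilde) l) ->
   globally_exponentially_stable F)
  /\
  ((exists2 z : R, 0 < z & invariant_zero A0 b c^T (real_complex R z)) ->
   has_unbounded_trajectory F).
Proof.
move=> _ d0 [r0 wB wr] al0 G_pd hA0 A0 alpha phi b theta v1 v2T Atilde btilde eta F.
have e0 : 0 < alpha * d by rewrite mulr_gt0 // prodr_gt0.
have A0E : A0 = A + B *m - K by rewrite mulmxN.
have wA0 i : (i < r)%N -> c^T *m A0 ^+ i = c^T *m A ^+ i.
  by move=> ir; rewrite A0E (feedback_pow wB).
have wb i : (i.+1 < r)%N -> c^T *m A0 ^+ i *m b = 0.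
  by move=> ir; rewrite wA0 1?ltnW // /b !mulmxA wB // !mul0mx.
have thetaE : theta = (c^T *m A0 ^+ r.-1 *m b) 0 0.
  by rewrite wA0 // prednK.
have theta0 : (c^T *m A0 ^+ r.-1 *m b) 0 0 != 0.
  rewrite -thetaE /theta /b -!mulmxA.
  have -> : B^T *m (A^T ^+ r.-1 *m c) = (c^T *m A ^+ r.-1 *m B)^T.
    by rewrite !trmx_mul trmxK trmx_exp.
  by rewrite !mulmxA; apply: lt0r_neq0; apply: posdef_inv_gt0.
have v2E : v2T = c^T *m horner_mx A0 phi.
  rewrite A0E (feedback_poly wB) ?phi_monic ?size_phi //.
  by rewrite /v2T mulmxBr !mulmxA mulmxN.
have AtE : Atilde = A0 + (- ((c^T *m A0 ^+ r.-1 *m b) 0 0)^-1 *: b) *m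
                         (c^T *m horner_mx A0 phi).
  by rewrite /Atilde v2E /v1 thetaE.
split=> [zeros neg | [z z0 zero_z]].
- have hAt : hurwitz Atilde by rewrite AtE; apply: hurwitz_constrained.
  have spec l : l <= 0 -> ~~ eigenvalue (A0 *m Atilde) l.
    rewrite le_eqVlt => /orP[/eqP -> | /neg //].
    rewrite eigenvalue_unitmx raddf0 subr0 negbK unitmx_mul.
    by apply/andP; split; [exact: hurwitz_unitmx hA0 | exact: hurwitz_unitmx hAt].
  have [P [e [c' [mu [PT e_gt0 c_gt0 mu_gt0 [bounds decay]]]]]] :=
    common_lyapunov hA0 spec.
  apply: (lyapunov_ges PT e_gt0 c_gt0 mu_gt0 bounds) => x.
  (* Both branches of [F] are [A0 x + psi v1] with [psi] the negative part of [eta]. *)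
have FE : F x = A0 *m x + (if 0 <= eta x then 0 else eta x) *: v1.
    rewrite /F; case: ifP => _; first by rewrite scale0r addr0.
    rewrite /Atilde mulmxDl -mulmxA [v2T *m x]mx11_scalar mul_mx_scalar.
    by rewrite -addrA -scalerDl.
  rewrite FE; apply: decay; case: ifP => [_|]; first by rewrite mul0r.
  move/negbT; rewrite -ltNge => eta_lt0.
  have -> : (v2T *m x) 0 0 - eta x = - (alpha * d) by rewrite /eta opprD addNKr.
  by rewrite mulrN -mulNr mulr_ge0 // ?ltW // oppr_gt0.
- have [w Aw vw] := positive_zero_mode alphas wb r0 theta0 hA0 z0 zero_z.
  rewrite -AtE -v2E in Aw vw.
  apply: (unstable_affine_unbounded (bt := btilde) z0 e0 Aw vw) => x.
  by rewrite -/(eta x) /F ltNge => /negbTE ->.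
Qed.
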